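(* Let $\phi:\Sigma^2\rightarrow \mathrm{Sol}_3$ be a surface of $\mathrm{Sol}_3$, with unit normal vector field $\xi$, shape operator $A$, mean curvature function $f=\frac12\operatorname{trace}A$ and Gaussian curvature $K$. Then $$ \begin{aligned} \tfrac{1}{2}\Delta\left(|A|^2+2\langle\xi,E_3^{\perp}\rangle^2\right)={}&|\nabla A|^2-4|\operatorname{grad} f|^2-2\langle\xi,E_3^{\perp}\rangle\langle\operatorname{grad} f,E_3^{\top}\rangle\\ &+2\operatorname{div}(A(\operatorname{grad} f))-6\operatorname{div}(f\langle\xi,E_3^{\perp}\rangle E_3^{\top})\\ &+2K(|A|^2-2f^2)+2\langle\xi,E_3^{\perp}\rangle^2(|A|^2+2f^2-3)\\ &-2\langle AE_3^{\top},AE_3^{\top}\rangle-2f\langle AE_3^{\top},E_3^{\top}\rangle\\ &+2-2\left(\langle\xi,E_2^{\perp}\rangle^2-\langle\xi,E_1^{\perp}\rangle^2\right)^2 . \end{aligned} $$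
   Context: $\mathrm{Sol}_3$ is $\mathbb{R}^3$ with coordinates $(x,y,z)$ and the Riemannian metric $\langle\cdot,\cdot\rangle=e^{2z}dx^2+e^{-2z}dy^2+dz^2$. Its canonical orthonormal frame is $E_1=e^{-z}\partial_x$, $E_2=e^{z}\partial_y$, $E_3=\partial_z$; $\bar\nabla$ is its Levi-Civita connection. A surface $\phi:\Sigma^2\to\mathrm{Sol}_3$ means a smooth isometric immersion of a connected Riemannian surface without boundary, equipped with a unit normal vector field $\xi$. For a vector field $X$ on $\mathrm{Sol}_3$, $X^{\top}$ and $X^{\perp}$ denote its tangent and normal parts along $\Sigma^2$ (so $\langle\xi,E_k^{\perp}\rangle=\langle\xi,E_k\rangle$). $\nabla$ is the induced Levi-Civita connection on $\Sigma^2$; the shape operator $A$ is defined by $AX=-\bar\nabla_X\xi$ for $X$ tangent; $f=\frac12\operatorname{trace}A$ is the mean curvature function; $K$ is the Gaussian curvature of the induced metric. $|A|^2=\operatorname{trace}(A^2)$, $|\nabla A|^2=\sum_{i,j}|(\nabla_{X_i}A)X_j|^2$ for a local orthonormal frame $\{X_1,X_2\}$ of $\Sigma^2$, and $\operatorname{grad}$, $\operatorname{div}$, $\Delta=\operatorname{div}\operatorname{grad}$ are taken on $\Sigma^2$ with the induced metric. *)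

(* Defs.v *)
From HB Require Import structures.
From mathcomp Require Import all_boot all_order all_algebra.
From mathcomp Require Import all_classical all_reals all_analysis.

Set Implicit Arguments.
Unset Strict Implicit.
Unset Printing Implicit Defensive.

Import Order.TTheory GRing.Theory Num.Theory.
Import numFieldNormedType.Exports.

Local Open Scope classical_set_scope.
Local Open Scope ring_scope.

(** * Calculus on open subsets of R^n *)

Definition partial (R : realType) (n : nat) (W : normedModType R) (i : 'I_n)
    (f : 'rV[R]_n -> W) (u : 'rV[R]_n) : W :=
  'D_(delta_mx 0 i) f u.

Fixpoint Ck (R : realType) (n : nat) (W : normedModType R) (k : nat)
    (U : set 'rV[R]_n) (f : 'rV[R]_n -> W) : Prop :=
  (forall u, U u -> {for u, continuous f}) /\
  (if k is k'.+1 then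
     forall i : 'I_n,
       (forall u, U u -> derivable f u (delta_mx 0 i)) /\
       Ck k' U (partial i f)
   else True).

Definition smooth (R : realType) (n : nat) (W : normedModType R)
    (U : set 'rV[R]_n) (f : 'rV[R]_n -> W) : Prop :=
  forall k, Ck k U f.

(** * Riemannian geometry in coordinates

    A metric on a coordinate domain of R^n is the function [g] giving its Gram
    matrix g_ij = <d_i, d_j> at each point; a vector field is given by its row
    of components in the coordinate basis.  An endomorphism field [T] acts on
    rows by [X *m T]: row [i] of [T u] is the image of d_i. *)

Definition inner (R : realType) (n : nat) (g : 'rV[R]_n -> 'M[R]_n)
    (u v w : 'rV[R]_n) : R :=
  (v *m g u *m w^T) 0 0.

Definition coordf (R : realType) (n : nat) (i : 'I_n) (u : 'rV[R]_n) :
    'rV[R]_n :=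
  delta_mx 0 i.

(* The symbol Gamma^k_ij of the Levi-Civita connection of [g]. *)
Definition christoffel (R : realType) (n : nat) (g : 'rV[R]_n -> 'M[R]_n)
    (k i j : 'I_n) (u : 'rV[R]_n) : R :=
  2^-1 * \sum_(l < n) invmx (g u) k l *
    (partial i (fun v => g v j l) u + partial j (fun v => g v i l) u
     - partial l (fun v => g v i j) u).

(* nabla_X Y *)
Definition covder (R : realType) (n : nat) (g : 'rV[R]_n -> 'M[R]_n)
    (X Y : 'rV[R]_n -> 'rV[R]_n) (u : 'rV[R]_n) : 'rV[R]_n :=
  \row_k \sum_(i < n) X u 0 i *
    (partial i Y u 0 k + \sum_(j < n) christoffel g k i j u * Y u 0 j).

(* nabla_{d_i} V for a vector field [V] along a map [F] into a coordinate
   domain of R^m carrying the metric [h]. *)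
Definition covder_along (R : realType) (n m : nat) (h : 'rV[R]_m -> 'M[R]_m)
    (F : 'rV[R]_n -> 'rV[R]_m) (i : 'I_n) (V : 'rV[R]_n -> 'rV[R]_m)
    (u : 'rV[R]_n) : 'rV[R]_m :=
  partial i V u +
  \row_c \sum_(a < m) \sum_(b < m)
    christoffel h c a b (F u) * partial i F u 0 a * V u 0 b.

(* (nabla_X T) Y *)
Definition covder_end (R : realType) (n : nat) (g : 'rV[R]_n -> 'M[R]_n)
    (T : 'rV[R]_n -> 'M[R]_n) (X Y : 'rV[R]_n -> 'rV[R]_n) (u : 'rV[R]_n) :
    'rV[R]_n :=
  covder g X (fun v => Y v *m T v) u - covder g X Y u *m T u.

Definition grad (R : realType) (n : nat) (g : 'rV[R]_n -> 'M[R]_n)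
    (f : 'rV[R]_n -> R) (u : 'rV[R]_n) : 'rV[R]_n :=
  \row_i \sum_(j < n) invmx (g u) i j * partial j f u.

(* The trace of X |-> nabla_X Y. *)
Definition div (R : realType) (n : nat) (g : 'rV[R]_n -> 'M[R]_n)
    (Y : 'rV[R]_n -> 'rV[R]_n) (u : 'rV[R]_n) : R :=
  \sum_(i < n) covder g (coordf i) Y u 0 i.

Definition laplacian (R : realType) (n : nat) (g : 'rV[R]_n -> 'M[R]_n)
    (f : 'rV[R]_n -> R) : 'rV[R]_n -> R :=
  div g (grad g f).

(* R(d_i, d_j) d_k, with the convention
   R(X, Y) = [nabla_X, nabla_Y] - nabla_[X, Y]; here [d_i, d_j] = 0. *)
Definition curvature (R : realType) (n : nat) (g : 'rV[R]_n -> 'M[R]_n)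
    (i j k : 'I_n) (u : 'rV[R]_n) : 'rV[R]_n :=
  covder g (coordf i) (covder g (coordf j) (coordf k)) u
  - covder g (coordf j) (covder g (coordf i) (coordf k)) u.

Definition gauss_curvature (R : realType) (g : 'rV[R]_2 -> 'M[R]_2)
    (u : 'rV[R]_2) : R :=
  inner g u (curvature g ord0 ord_max ord_max u) (coordf ord0 u) / \det (g u).

Definition orthonormal_frame (R : realType) (n : nat)
    (g : 'rV[R]_n -> 'M[R]_n) (V : set 'rV[R]_n)
    (X : 'I_n -> 'rV[R]_n -> 'rV[R]_n) : Prop :=
  (forall i, smooth V (X i)) /\
  (forall u i j, V u -> inner g u (X i u) (X j u) = (i == j)%:R).

(* |nabla T|^2, computed in the frame [X]. *)
Definition norm2_covder_end (R : realType) (n : nat)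
    (g : 'rV[R]_n -> 'M[R]_n) (X : 'I_n -> 'rV[R]_n -> 'rV[R]_n)
    (T : 'rV[R]_n -> 'M[R]_n) (u : 'rV[R]_n) : R :=
  \sum_(i < n) \sum_(j < n)
    inner g u (covder_end g T (X i) (X j) u) (covder_end g T (X i) (X j) u).

(** * Abstract Riemannian surfaces *)

Record chart (R : realType) (M : topologicalType) := Chart {
  source : set M;
  target : set 'rV[R]_2;
  coords : M -> 'rV[R]_2;
  param : 'rV[R]_2 -> M;
  source_open : open source;
  target_open : open target;
  coords_target : forall p, source p -> target (coords p);
  param_source : forall u, target u -> source (param u);
  coordsK : forall p, source p -> param (coords p) = p;
  paramK : forall u, target u -> coords (param u) = u;
  coords_continuous : {within source, continuous coords};
  param_continuous : {within target, continuous param}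
}.

(* The part of the target of [c] on which the transition map
   [coords d \o param c] is defined. *)
Definition overlap (R : realType) (M : topologicalType) (c d : chart R M) :
    set 'rV[R]_2 :=
  [set u | target c u /\ source d (param c u)].

Record riemSurface (R : realType) := RiemSurface {
  points :> topologicalType;
  surface_hausdorff : hausdorff_space points;
  surface_second_countable : @second_countable points;
  surface_connected : connected [set: points];
  atlas : set (chart R points);
  atlas_cover : forall p : points, exists2 c, atlas c & source c p;
  atlas_smooth : forall c d, atlas c -> atlas d ->
    smooth (overlap c d) (coords d \o param c);
  metric : chart R points -> 'rV[R]_2 -> 'M[R]_2;
  metric_smooth : forall c, atlas c -> smooth (target c) (metric c);
  metric_sym : forall c u, atlas c -> target c u ->
    (metric c u)^T = metric c u;
  metric_pos : forall c u v, atlas c -> target c u -> v != 0 ->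
    0 < inner (metric c) u v v;
  metric_compat : forall c d u i j, atlas c -> atlas d -> overlap c d u ->
    metric c u i j =
    inner (metric d) (coords d (param c u))
      (partial i (coords d \o param c) u) (partial j (coords d \o param c) u)
}.

(** * The space Sol_3 *)

Definition sol_z (R : realType) (p : 'rV[R]_3) : R := p 0 ord_max.

Definition sol_metric (R : realType) (p : 'rV[R]_3) : 'M[R]_3 :=
  diag_mx (\row_k [:: expR (2 * sol_z p); expR (- 2 * sol_z p); 1]`_k).

Definition sol_E1 (R : realType) (p : 'rV[R]_3) : 'rV[R]_3 :=
  \row_k [:: expR (- sol_z p); 0; 0]`_k.

Definition sol_E2 (R : realType) (p : 'rV[R]_3) : 'rV[R]_3 :=
  \row_k [:: 0; expR (sol_z p); 0]`_k.

Definition sol_E3 (R : realType) (p : 'rV[R]_3) : 'rV[R]_3 :=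
  \row_k [:: 0; 0; 1]`_k.

(** * Surfaces in Sol_3 *)

(* The isometry condition makes the differential injective, the metric of [Sigma]
   being positive definite. *)
Definition isometric_immersion (R : realType) (Sigma : riemSurface R)
    (phi : Sigma -> 'rV[R]_3) : Prop :=
  forall c, atlas c ->
    smooth (target c) (phi \o param c) /\
    forall u i j, target c u ->
      metric c u i j =
      inner (@sol_metric R) (phi (param c u))
        (partial i (phi \o param c) u) (partial j (phi \o param c) u).

(* [xi p] is the row of components of a vector of T_(phi p) Sol_3 in the
   coordinate basis d_x, d_y, d_z. *)
Definition unit_normal_field (R : realType) (Sigma : riemSurface R)
    (phi xi : Sigma -> 'rV[R]_3) : Prop :=
  forall c, atlas c ->
    smooth (target c) (xi \o param c) /\
    forall u, target c u ->
      inner (@sol_metric R) (phi (param c u)) (xi (param c u))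
        (xi (param c u)) = 1 /\
      forall i, inner (@sol_metric R) (phi (param c u)) (xi (param c u))
        (partial i (phi \o param c) u) = 0.

(* Below, [g] is the metric of the surface and [F] the immersion, both read in
   a chart, and vector fields along [F] are given by their components in the
   coordinate basis of Sol_3. *)

Definition pushforward (R : realType) (F : 'rV[R]_2 -> 'rV[R]_3)
    (X : 'rV[R]_2 -> 'rV[R]_2) (u : 'rV[R]_2) : 'rV[R]_3 :=
  \sum_(i < 2) X u 0 i *: partial i F u.

(* The tangent part of [V], as a vector field on the surface: it is the only
   field whose inner product with each d_l is that of [V] with dF(d_l). *)
Definition tangent_part (R : realType) (g : 'rV[R]_2 -> 'M[R]_2)
    (F V : 'rV[R]_2 -> 'rV[R]_3) (u : 'rV[R]_2) : 'rV[R]_2 :=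
  \row_j \sum_(l < 2)
    inner (@sol_metric R) (F u) (V u) (partial l F u) * invmx (g u) l j.

Definition normal_part (R : realType) (g : 'rV[R]_2 -> 'M[R]_2)
    (F V : 'rV[R]_2 -> 'rV[R]_3) (u : 'rV[R]_2) : 'rV[R]_3 :=
  V u - pushforward F (tangent_part g F V) u.

(* Row [i] is A d_i = - nabla_{d_i} N, where nabla is the connection of Sol_3.
   As [N] has unit length the right-hand side is tangent, so [tangent_part]
   only reads it as a vector on the surface. *)
Definition shape_operator (R : realType) (g : 'rV[R]_2 -> 'M[R]_2)
    (F N : 'rV[R]_2 -> 'rV[R]_3) (u : 'rV[R]_2) : 'M[R]_2 :=
  \matrix_(i < 2)
    tangent_part g F (fun v => - covder_along (@sol_metric R) F i N v) u.

(* Main.v *)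
Require Import Defs.
From HB Require Import structures.
From mathcomp Require Import all_boot all_order all_algebra.
From mathcomp Require Import all_classical all_reals all_analysis.
From mathcomp Require Import ring.
Set Implicit Arguments.
Unset Strict Implicit.
Unset Printing Implicit Defensive.
Import Order.TTheory GRing.Theory Num.Theory.
Import numFieldNormedType.Exports.
Local Open Scope classical_set_scope.
Local Open Scope ring_scope.

(** All the quantities live in the commutative ring of smooth functions on the
    open set [V], in which the partial derivatives are commuting derivations;
    over it the theorem becomes an identity between polynomials in finitely many
    functions and their derivatives.

    Let (e1, e2) be the given orthonormal frame and xi the normal, all three
    expanded in the frame (E1, E2, E3).  Write t1, t2, n for their components
    on E3, h for the second fundamental form and S for the symmetric
    endomorphism X |-> nabla_X E3 of Sol_3, that is E1 (x) E1 - E2 (x) E2.  The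
    first derivatives of t1, t2, n and of the entries of S are polynomial in
    these functions, the entries of h and the connection coefficients of the
    frame.  As the curvature operator of Sol_3 is diag(-1, -1, 1) on the basis
    (E2/\E3, E3/\E1, E1/\E2), the Codazzi equation reads
    (nabla_X A) Y - (nabla_Y A) X = 2 n (<Y, T> X - <X, T> Y), with T the
    tangent part of E3.  As in the proof of Simons' identity, this equation and
    the commutation of derivatives, which brings in K, turn <A, Delta A> into
    2 <A, Hess f> plus algebraic terms.  The Laplacian of n^2 is computed from
    the first derivatives, and the two sums match because of tr S = 0,
    S E3 = 0 and |S xi|^2 = 1 - n^2. *)

(** * Derivations of a commutative ring *)

Definition derivation (C : comPzRingType) (D : C -> C) :=
  (forall x y, D (x + y) = D x + D y) /\
  (forall x y, D (x * y) = D x * y + x * D y).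

Section Derivation.
Variables (C : comPzRingType) (D : C -> C) (hD : derivation D).

Lemma derD x y : D (x + y) = D x + D y. Proof. exact: hD.1. Qed.
Lemma derM x y : D (x * y) = D x * y + x * D y. Proof. exact: hD.2. Qed.
Lemma der0 : D 0 = 0.
Proof. by apply: (addrI (D 0)); rewrite -derD !addr0. Qed.
Lemma der1 : D 1 = 0.
Proof. by apply: (addrI (D 1)); rewrite -{3}[1]mulr1 derM mulr1 mul1r addr0. Qed.
Lemma derN x : D (- x) = - D x.
Proof. by apply: (addrI (D x)); rewrite -derD !subrr der0. Qed.
Lemma derMn x k : D (x *+ k) = D x *+ k.
Proof. by elim: k => [|k IH]; rewrite ?mulr0n ?der0 // !mulrS derD IH. Qed.
Definition derE := (derD, derM, derN, derMn, der1, der0).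
End Derivation.

(* The divergence of y1 e1 + y2 e2 in an orthonormal frame with
   nabla_e1 e1 = a e2 and nabla_e2 e1 = b e2. *)
Definition fdiv (C : comPzRingType) (D1 D2 : C -> C) (a b y1 y2 : C) : C :=
  D1 y1 + D2 y2 + b * y1 - a * y2.

(* [p], [q], [r] are the entries of the shape operator, [t1], [t2], [n] the
   components of E3 and [Sij] the entries of X |-> nabla_X E3 in the frame
   (e1, e2, xi); [cod1] and [cod2] are the Codazzi equations. *)
Lemma simons_identity (C : comPzRingType) (D1 D2 : C -> C)
  (hD1 : derivation D1) (hD2 : derivation D2) (a b K : C)
  (comm : forall x, D1 (D2 x) = D2 (D1 x) - a * D1 x - b * D2 x)
  (hK : K = D2 a - D1 b - a * a - b * b)
  (p q r f t1 t2 n S11 S12 S22 S13 S23 S33 : C)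
  (hf : f + f = p + r)
  (D1t1 : D1 t1 = a * t2 + p * n + S11)
  (D2t1 : D2 t1 = b * t2 + q * n + S12)
  (D1t2 : D1 t2 = - a * t1 + q * n + S12)
  (D2t2 : D2 t2 = - b * t1 + r * n + S22)
  (D1n : D1 n = - p * t1 - q * t2 + S13)
  (D2n : D2 n = - q * t1 - r * t2 + S23)
  (D1S13 : D1 S13 = a * S23 + p * S33 - p * S11 - q * S12 - n + 2 * n * t1 * t1)
  (D2S23 : D2 S23 = - b * S13 + r * S33 - q * S12 - r * S22 - n + 2 * n * t2 * t2)
  (cod1 : D1 q = D2 p + a * (r - p) - 2 * b * q + 2 * n * t2)
  (cod2 : D1 r = D2 q + b * (p - r) - 2 * a * q - 2 * n * t1)
  (trS : S11 + S22 + S33 = 0)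
  (normS3 : S13 * S13 + S23 * S23 + S33 * S33 + n * n = 1)
  (SE3 : S13 * t1 + S23 * t2 + S33 * n = 0)
  (dvg := fdiv D1 D2 a b) (lap := fun x => dvg (D1 x) (D2 x)) :
  lap (p * p + 2 * (q * q) + r * r + 2 * (n * n)) = 2 *
   ((D1 p - 2 * a * q) ^+ 2 + 2 * (D1 q + a * (p - r)) ^+ 2
      + (D1 r + 2 * a * q) ^+ 2
    + ((D2 p - 2 * b * q) ^+ 2 + 2 * (D2 q + b * (p - r)) ^+ 2
      + (D2 r + 2 * b * q) ^+ 2)
    - 4 * (D1 f * D1 f + D2 f * D2 f) - 2 * n * (D1 f * t1 + D2 f * t2)
    + 2 * dvg (p * D1 f + q * D2 f) (q * D1 f + r * D2 f)
    - 6 * dvg (f * n * t1) (f * n * t2)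
    + 2 * K * (p * p + 2 * (q * q) + r * r - 2 * (f * f))
    + 2 * (n * n) * (p * p + 2 * (q * q) + r * r + 2 * (f * f) - 3)
    - 2 * ((p * t1 + q * t2) ^+ 2 + (q * t1 + r * t2) ^+ 2)
    - 2 * f * (p * t1 * t1 + 2 * (q * t1 * t2) + r * t2 * t2)
    + 2 - 2 * (S33 * S33)).
Proof.
(* The mean curvature relation and the trace of S are solved for [p] and [S22], which keeps every
   coefficient an integer; the definition of [K] is turned into a rule for [D1 b]. *)
have pE : p = f + f - r by rewrite hf addrK.
have S22E : S22 = - S11 - S33 by rewrite -[RHS]addr0 -trS; ring.
have {}hK : D1 b = D2 a - a * a - b * b - K by rewrite hK; ring.
rewrite {}/lap {}/dvg /fdiv; clear hf trS; subst p S22.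
rewrite ?(derE hD1) ?(derE hD2) in cod1 cod2 D1t1 *.
(* Each rule can produce new derivatives to be reduced, hence the repeated passes. At the end [D2]
   stands outside [D1], and the Codazzi equations have removed [D1] of [q] and [r]. *)
do 8 rewrite ?(derE hD1) ?(derE hD2) ?comm ?cod1 ?cod2 ?hK ?D1t1 ?D2t1 ?D1t2
  ?D2t2 ?D1n ?D2n ?D1S13 ?D2S23.
have r2 : S13 * S13 + S23 * S23 + S33 * S33 + n * n - 1 = 0.
  by rewrite normS3 subrr.
apply/subr0_eq.
(* Two relations have not been used as rewriting rules, |S xi|^2 = 1 - n^2 and <S E3, xi> = 0; the
   difference of the two sides is this combination of them. *)
match goal with |- ?G = 0 => have -> : G
  = 4 * (S13 * S13 + S23 * S23 + S33 * S33 + n * n - 1)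
    + 4 * f * (S13 * t1 + S23 * t2 + S33 * n) end; first by ring.
by rewrite r2 SE3; ring.
Qed.

(** * Vectors along a surface of Sol_3 *)

Section Vectors.
Variable C : comPzRingType.
Implicit Types (u v w e : C * C * C) (D : C -> C).

Definition dot u v : C := u.1.1 * v.1.1 + u.1.2 * v.1.2 + u.2 * v.2.

(* The covariant derivative in Sol_3, in the direction [e] inducing [D], of the
   field with components [v] in the frame (E1, E2, E3): the nonzero derivatives
   of the frame are nabla_E1 E1 = - E3, nabla_E1 E3 = E1, nabla_E2 E2 = E3 and
   nabla_E2 E3 = - E2. *)
Definition nab D e v : C * C * C :=
  (D v.1.1 + e.1.1 * v.2, D v.1.2 - e.1.2 * v.2,
   D v.2 - e.1.1 * v.1.1 + e.1.2 * v.1.2).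

(** The coefficient of E1 /\ E2 in u /\ v, the only direction where the curvature operator differs
    from minus the identity. *)
Definition wedge12 u v : C := u.1.1 * v.1.2 - u.1.2 * v.1.1.

(* <nabla_u E3, v> *)
Definition solS u v : C := u.1.1 * v.1.1 - u.1.2 * v.1.2.

Lemma dotC u v : dot u v = dot v u. Proof. by rewrite /dot; ring. Qed.

(** Compatibility of the connection with the metric. *)
Lemma nab_dot D e u v : derivation D ->
  D (dot u v) = dot (nab D e u) v + dot u (nab D e v).
Proof. by move=> hD; rewrite /dot /nab /= !(derE hD); ring. Qed.

(** Compatibility again, applied to [v.2] = <v, E3>. *)
Lemma nab_third D e v : derivation D -> D v.2 = (nab D e v).2 + solS e v.
Proof. by move=> hD; rewrite /nab /solS /=; ring. Qed.

(** The last two terms are (nabla_e S)(u, v); their parentheses are products of components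
    orthogonal to E3. *)
Lemma nab_solS D e u v : derivation D ->
  D (solS u v) = solS (nab D e u) v + solS u (nab D e v)
    - u.2 * (dot e v - e.2 * v.2) - v.2 * (dot e u - e.2 * u.2).
Proof. by move=> hD; rewrite /solS /dot /nab /= !(derE hD); ring. Qed.

(* The last two terms are <R(e1, e2) v, w>, for R the curvature of Sol_3. *)
Lemma nab_comm D1 D2 (al be : C) e1 e2 v w :
  derivation D1 -> derivation D2 ->
  (forall x, D1 (D2 x) = D2 (D1 x) + al * D1 x + be * D2 x) ->
  (nab D1 e1 e2).1.1 = (nab D2 e2 e1).1.1 + al * e1.1.1 + be * e2.1.1 ->
  (nab D1 e1 e2).1.2 = (nab D2 e2 e1).1.2 + al * e1.1.2 + be * e2.1.2 ->
  dot (nab D1 e1 (nab D2 e2 v)) w = dot (nab D2 e2 (nab D1 e1 v)) w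
    + al * dot (nab D1 e1 v) w + be * dot (nab D2 e2 v) w
    + 2 * (wedge12 e1 e2 * wedge12 w v)
    - (dot e1 w * dot e2 v - dot e1 v * dot e2 w).
Proof.
move=> hD1 hD2 comm T1 T2.
(* The torsion equations, solved for one derivative, become rewriting rules. *)
have {}T1 : D1 e2.1.1 = D2 e1.1.1 + e2.1.1 * e1.2 - e1.1.1 * e2.2
    + al * e1.1.1 + be * e2.1.1.
  by move: T1; rewrite /= => /(canRL (addrK _)) ->; ring.
have {}T2 : D1 e2.1.2 = D2 e1.1.2 - e2.1.2 * e1.2 + e1.1.2 * e2.2
    + al * e1.1.2 + be * e2.1.2.
  by move: T2; rewrite /= => /(canRL (subrK _)) ->; ring.
rewrite /dot /nab /wedge12 /= !(derE hD1) !(derE hD2) !comm T1 T2.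
ring.
Qed.

(** Here [ez] and [emz] stand for exp z and exp (- z) along the map (f0, f1, f2), and the field has
    coordinate components (v0, v1, v2). The factors in parentheses on the right, and the third
    component, are the covariant derivative in the coordinate basis. *)
Lemma nab_solvec D (ez emz f0 f1 f2 v0 v1 v2 : C) : derivation D ->
  D ez = ez * D f2 -> D emz = emz * - D f2 ->
  nab D (ez * D f0, emz * D f1, D f2) (ez * v0, emz * v1, v2) =
  (ez * (D v0 + (D f0 * v2 + D f2 * v0)),
   emz * (D v1 - (D f1 * v2 + D f2 * v1)),
   D v2 - ez * ez * D f0 * v0 + emz * emz * D f1 * v1).
Proof.
move=> hD dz dz'; rewrite /nab /= !(derM hD) dz dz'.
by congr (_, _, _); ring.
Qed.

(** The connection is torsion-free: the images of two commuting coordinate fields have symmetric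
    covariant derivatives. *)
Lemma nab_solvecC D1 D2 (ez emz f0 f1 f2 : C) :
  derivation D1 -> derivation D2 -> (forall c, D1 (D2 c) = D2 (D1 c)) ->
  D1 ez = ez * D1 f2 -> D1 emz = emz * - D1 f2 ->
  D2 ez = ez * D2 f2 -> D2 emz = emz * - D2 f2 ->
  nab D1 (ez * D1 f0, emz * D1 f1, D1 f2) (ez * D2 f0, emz * D2 f1, D2 f2) =
  nab D2 (ez * D2 f0, emz * D2 f1, D2 f2) (ez * D1 f0, emz * D1 f1, D1 f2).
Proof.
move=> hD1 hD2 comm d1 d1' d2 d2'; rewrite !nab_solvec // !comm.
by congr (_, _, _); ring.
Qed.

End Vectors.

(** * Orthonormal triples and the traces of S *)

Section OrthonormalTriple.
Variable C : comPzRingType.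
Implicit Types (u v w e : C * C * C) (D : C -> C).

Definition orthonormal3 u v w : Prop :=
  [/\ dot u u = 1, dot v v = 1 & dot w w = 1] /\
  [/\ dot u v = 0, dot u w = 0 & dot v w = 0].

Let simp := (mulr0, mul0r, addr0, add0r, mulr1, mul1r).
Variables x y n : C * C * C.
Hypothesis hO : orthonormal3 x y n.

(** The matrix O with rows x, y, n satisfies O O^T = 1, hence O^T O = 1, since one-sided inverses of
    square matrices over a commutative ring are two-sided. *)
Lemma parseval u v :
  dot u v = dot u x * dot v x + dot u y * dot v y + dot u n * dot v n.
Proof.
have [[xx yy nn] [xy xn yn]] := hO.
pose O : 'M[C]_3 := \matrix_(i, j)
  let w := nth x [:: x; y; n] i in [:: w.1.1; w.1.2; w.2]`_j.
have OOt : O *m O^T = 1%:M.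
  apply/matrixP => i j; rewrite !mxE !big_ord_recr big_ord0 /= add0r !mxE /=.
  by case: i => [[|[|[|//]]] ?]; case: j => [[|[|[|//]]] ?];
    rewrite /= -/(dot _ _) // dotC.
have OtO i j : (O^T *m O) i j = (i == j)%:R by rewrite (mulmx1C OOt) mxE.
have := (OtO 0 0, OtO 0 1, OtO 0 (inord 2), OtO 1 1, OtO 1 (inord 2),
         OtO (inord 2) (inord 2)).
rewrite !mxE !big_ord_recr !big_ord0 /= !add0r !mxE /= -!val_eqE /= !inordK //=.
move=> [[[[[c00 c01] c02] c11] c12] c22].
symmetry.
(* The sum is regrouped along the entries of O^T O. *)
transitivity (u.1.1 * v.1.1 * (x.1.1 * x.1.1 + y.1.1 * y.1.1 + n.1.1 * n.1.1)
  + u.1.2 * v.1.2 * (x.1.2 * x.1.2 + y.1.2 * y.1.2 + n.1.2 * n.1.2)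
  + u.2 * v.2 * (x.2 * x.2 + y.2 * y.2 + n.2 * n.2)
  + (u.1.1 * v.1.2 + u.1.2 * v.1.1)
    * (x.1.1 * x.1.2 + y.1.1 * y.1.2 + n.1.1 * n.1.2)
  + (u.1.1 * v.2 + u.2 * v.1.1) * (x.1.1 * x.2 + y.1.1 * y.2 + n.1.1 * n.2)
  + (u.1.2 * v.2 + u.2 * v.1.2) * (x.1.2 * x.2 + y.1.2 * y.2 + n.1.2 * n.2)).
  by rewrite /dot; ring.
by rewrite c00 c11 c22 c01 c02 c12 /dot; ring.
Qed.

Lemma expand_third u :
  u.2 = dot u x * x.2 + dot u y * y.2 + dot u n * n.2.
Proof.
by have := parseval u (0, 0, 1); rewrite /dot /= !simp.
Qed.

(** [parseval] for u and S v = (v_1, - v_2, 0); the same vector serves in [solS_third] and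
    [solS_sqr]. *)
Lemma expand_solS u v :
  solS u v = dot u x * solS x v + dot u y * solS y v + dot u n * solS n v.
Proof.
have := parseval u (v.1.1, - v.1.2, 0); rewrite /dot /solS /= !simp => e.
by transitivity (u.1.1 * v.1.1 + u.1.2 * - v.1.2); [|rewrite e]; ring.
Qed.

(** The trace of S is the squared norm of the first column of the triple minus that of the second,
    that is 1 - 1. *)
Lemma solS_tr : solS x x + solS y y + solS n n = 0.
Proof.
have := parseval (1, 0, 0) (1, 0, 0); have := parseval (0, 1, 0) (0, 1, 0).
rewrite /dot /solS /= !simp => e2 e1.
by rewrite -(subrr 1) {1}e1 e2; ring.
Qed.

Lemma solS_third w : solS x w * x.2 + solS y w * y.2 + solS n w * n.2 = 0.
Proof.
have := parseval (w.1.1, - w.1.2, 0) (0, 0, 1).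
by rewrite /dot /solS /= !simp => ->; ring.
Qed.

Lemma solS_sqr w :
  solS x w ^+ 2 + solS y w ^+ 2 + solS n w ^+ 2 = dot w w - w.2 ^+ 2.
Proof.
have := parseval (w.1.1, - w.1.2, 0) (w.1.1, - w.1.2, 0).
rewrite /dot /solS /= !simp mulrNN => e.
transitivity (w.1.1 * w.1.1 + w.1.2 * w.1.2); last by ring.
by rewrite e; ring.
Qed.

(* The cofactors of an orthonormal matrix are, up to a common sign, its
   entries, and the sign disappears from the product. *)
Lemma wedge12_mul : wedge12 x y * wedge12 n x = n.2 * y.2.
Proof.
have [_ [_ _ yn]] := hO.
have := parseval (1, 0, 0) (1, 0, 0); have := parseval (0, 1, 0) (0, 1, 0).
have := parseval (1, 0, 0) (0, 1, 0).
rewrite /dot /= !simp in yn * => e12 e22 e11.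
(* Orthogonality of y and n removes the third components; the factors 1 are then replaced by the
   squared norms of the second and the first column. *)
have -> : n.2 * y.2 = 0 - y.1.1 * n.1.1 * 1 - y.1.2 * n.1.2 * 1.
  by rewrite -yn; ring.
rewrite {1}e22 e11 /wedge12.
(* The remaining discrepancy is a multiple of the product of the first two columns, which is 0. *)
set a := RHS; transitivity (a + 0 * (y.1.1 * n.1.2 + y.1.2 * n.1.1)).
  by rewrite e12 /a; ring.
by rewrite mul0r addr0.
Qed.
End OrthonormalTriple.

Lemma solSC (C : comPzRingType) (u v : C * C * C) : solS u v = solS v u.
Proof. by rewrite /solS; ring. Qed.

Lemma nab_skew (C : comPzRingType) (D : C -> C) (e u v : C * C * C) :
  derivation D -> D (dot u v) = 0 ->
  dot (nab D e u) v = - dot (nab D e v) u.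
Proof.
move=> hD; rewrite (nab_dot e _ _ hD) => /(canRL (addrK _)) ->.
by rewrite sub0r dotC.
Qed.

Lemma orthonormal3_swap (C : comPzRingType) (x y n : C * C * C) :
  orthonormal3 x y n -> orthonormal3 y x n.
Proof. by move=> [[? ? ?] [? ? ?]]; split; split; rewrite // dotC. Qed.

(** * Structure equations of a frame adapted to the surface *)

Section MovingFrame.
Variables (C : comPzRingType) (D1 D2 : C -> C).
Hypotheses (hD1 : derivation D1) (hD2 : derivation D2).
Hypothesis h2 : forall c : C, c + c = 0 -> c = 0.
Variables (a b : C) (x y n : C * C * C).
(** This is [x, y] = - a x - b y; [T1], [T2], [T3] are the three components of nabla_x y - nabla_y x
    = [x, y]. *)
Hypothesis comm : forall c, D1 (D2 c) = D2 (D1 c) - a * D1 c - b * D2 c.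
Hypothesis hO : orthonormal3 x y n.
Hypothesis T1 : (nab D1 x y).1.1 = (nab D2 y x).1.1 - a * x.1.1 - b * y.1.1.
Hypothesis T2 : (nab D1 x y).1.2 = (nab D2 y x).1.2 - a * x.1.2 - b * y.1.2.
Hypothesis T3 : (nab D1 x y).2 = (nab D2 y x).2 - a * x.2 - b * y.2.

(** By [nab_skew] the product is its own opposite, and [h2] concludes. *)
Lemma nab_self D e (u : C * C * C) : derivation D -> dot u u = 1 ->
  dot (nab D e u) u = 0.
Proof.
move=> hD uu; apply: h2; rewrite {2}(nab_skew e hD) ?addrN //.
by rewrite uu (der1 hD).
Qed.

Lemma nab_torsion w :
  dot (nab D1 x y) w = dot (nab D2 y x) w - a * dot x w - b * dot y w.
Proof. by rewrite {1}/dot T1 T2 T3 /dot; ring. Qed.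

(** Skewness moves the derivative onto y, and the torsion equation then leaves only the bracket
    coefficient. *)
Lemma frame_conn1 : dot (nab D1 x x) y = a.
Proof.
have [[xx yy nn] [xy xn yn]] := hO.
rewrite (nab_skew _ hD1) ?xy ?(der0 hD1) // nab_torsion.
by rewrite (nab_self _ hD2) // xx dotC xy; ring.
Qed.

Lemma frame_conn2 : dot (nab D2 y x) y = b.
Proof.
have [[xx yy nn] [xy xn yn]] := hO.
have := nab_torsion y; rewrite (nab_self _ hD1) // xy yy.
by move/esym/(canRL (subrK _))/(canRL (subrK _)) ->; ring.
Qed.

(** Symmetry of the second fundamental form: the bracket of x and y is tangent, hence orthogonal to
    n. *)
Lemma shape_sym : dot (nab D2 y n) x = dot (nab D1 x n) y.
Proof.
have [[xx yy nn] [xy xn yn]] := hO.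
have e1 : dot (nab D1 x y) n = - dot (nab D1 x n) y.
  by rewrite (nab_skew _ hD1) // yn (der0 hD1).
have e2 : dot (nab D2 y x) n = - dot (nab D2 y n) x.
  by rewrite (nab_skew _ hD2) // xn (der0 hD2).
by apply: oppr_inj; rewrite -e1 -e2 nab_torsion xn yn !mulr0 !subr0.
Qed.

(** The hypotheses of [simons_identity] are checked for a frame: the Gauss and Weingarten formulas
    are tabulated in [dots], and the Codazzi equations follow from the curvature. *)
Theorem frame_simons
  (p := - dot (nab D1 x n) x) (q := - dot (nab D1 x n) y)
  (r := - dot (nab D2 y n) y) (f : C) (hf : f + f = p + r)
  (K := D2 a - D1 b - a * a - b * b)
  (dvg := fdiv D1 D2 a b) (lap := fun x => dvg (D1 x) (D2 x)) :
  lap (p * p + 2 * (q * q) + r * r + 2 * (n.2 * n.2)) = 2 *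
   ((D1 p - 2 * a * q) ^+ 2 + 2 * (D1 q + a * (p - r)) ^+ 2
      + (D1 r + 2 * a * q) ^+ 2
    + ((D2 p - 2 * b * q) ^+ 2 + 2 * (D2 q + b * (p - r)) ^+ 2
      + (D2 r + 2 * b * q) ^+ 2)
    - 4 * (D1 f * D1 f + D2 f * D2 f) - 2 * n.2 * (D1 f * x.2 + D2 f * y.2)
    + 2 * dvg (p * D1 f + q * D2 f) (q * D1 f + r * D2 f)
    - 6 * dvg (f * n.2 * x.2) (f * n.2 * y.2)
    + 2 * K * (p * p + 2 * (q * q) + r * r - 2 * (f * f))
    + 2 * (n.2 * n.2) * (p * p + 2 * (q * q) + r * r + 2 * (f * f) - 3)
    - 2 * ((p * x.2 + q * y.2) ^+ 2 + (q * x.2 + r * y.2) ^+ 2)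
    - 2 * f * (p * x.2 * x.2 + 2 * (q * x.2 * y.2) + r * y.2 * y.2)
    + 2 - 2 * (n.1.1 * n.1.1 - n.1.2 * n.1.2) ^+ 2).
Proof.
have [[xx yy nn] [xy xn yn]] := hO.
have yx : dot y x = 0 by rewrite dotC.
have nx : dot n x = 0 by rewrite dotC.
have ny : dot n y = 0 by rewrite dotC.
have dO := (xx, yy, nn, xy, xn, yn, yx, nx, ny).
have [n1n n2n] := (nab_self x hD1 nn, nab_self y hD2 nn).
have [x1x x2x] := (nab_self x hD1 xx, nab_self y hD2 xx).
have [y1y y2y] := (nab_self x hD1 yy, nab_self y hD2 yy).
have [x1y x2y] := (frame_conn1, frame_conn2).
have y1x : dot (nab D1 x y) x = - a.
  by rewrite (nab_skew _ hD1) ?x1y // yx (der0 hD1).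
have y2x : dot (nab D2 y y) x = - b.
  by rewrite (nab_skew _ hD2) ?x2y // yx (der0 hD2).
have y1n : dot (nab D1 x y) n = q by rewrite (nab_skew _ hD1) // yn (der0 hD1).
have x1n : dot (nab D1 x x) n = p by rewrite (nab_skew _ hD1) // xn (der0 hD1).
have y2n : dot (nab D2 y y) n = r by rewrite (nab_skew _ hD2) // yn (der0 hD2).
have x2n : dot (nab D2 y x) n = q.
  by rewrite (nab_skew _ hD2) ?shape_sym // xn (der0 hD2).
have n1x : dot (nab D1 x n) x = - p by rewrite opprK.
have n1y : dot (nab D1 x n) y = - q by rewrite opprK.
have n2y : dot (nab D2 y n) y = - r by rewrite opprK.
have n2x : dot (nab D2 y n) x = - q by rewrite shape_sym opprK.
have dots := (n1n, n2n, x1x, x2x, y1y, y2y, y1x, x2y, x1y, y2x, y1n, x1n, y2n,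
  x2n, n1x, n1y, n2y, n2x).
have comm' c : D1 (D2 c) = D2 (D1 c) + - a * D1 c + - b * D2 c.
  by rewrite comm; ring.
have T1' : (nab D1 x y).1.1 = (nab D2 y x).1.1 + - a * x.1.1 + - b * y.1.1.
  by rewrite T1; ring.
have T2' : (nab D1 x y).1.2 = (nab D2 y x).1.2 + - a * x.1.2 + - b * y.1.2.
  by rewrite T2; ring.
have curv v w := nab_comm v w hD1 hD2 comm' T1' T2'.
(* Write q = <nabla_y x, n> and p = <nabla_x x, n>, differentiate along x and y respectively, and
   exchange the second derivatives by [curv]; [wedge12_mul] evaluates the curvature term. *)
have cod1 : D1 q = D2 p + a * (r - p) - 2 * b * q + 2 * n.2 * y.2.
  rewrite -{1}x2n (nab_dot x _ _ hD1) curv (wedge12_mul hO).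
  rewrite -{1}x1n (nab_dot y _ _ hD2).
  rewrite (parseval hO (nab D2 y x) (nab D1 x n)).
  rewrite (parseval hO (nab D1 x x) (nab D2 y n)) !dots !dO; ring.
have cod2 : D1 r = D2 q + b * (p - r) - 2 * a * q - 2 * n.2 * x.2.
  rewrite -{1}y2n (nab_dot x _ _ hD1) curv.
  (* The sign comes from exchanging x and y in [wedge12_mul]. *)
  have -> : wedge12 x y * wedge12 n y = - (n.2 * x.2).
    by rewrite -(wedge12_mul (orthonormal3_swap hO)) /wedge12; ring.
  rewrite -{1}y1n (nab_dot y _ _ hD2).
  rewrite (parseval hO (nab D2 y y) (nab D1 x n)).
  rewrite (parseval hO (nab D1 x y) (nab D2 y n)) !dots !dO; ring.
apply: (simons_identity (S11 := solS x x) (S12 := solS x y) (S22 := solS y y)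
  (S13 := solS x n) (S23 := solS y n) (S33 := solS n n) hD1 hD2 comm erefl hf) => //.
- rewrite (nab_third x _ hD1) (expand_third hO) !dots; ring.
- rewrite (nab_third y _ hD2) (expand_third hO) !dots (solSC y); ring.
- rewrite (nab_third x _ hD1) (expand_third hO) !dots; ring.
- rewrite (nab_third y _ hD2) (expand_third hO) !dots; ring.
- rewrite (nab_third x _ hD1) (expand_third hO) !dots; ring.
- rewrite (nab_third y _ hD2) (expand_third hO) !dots; ring.
- rewrite (nab_solS x _ _ hD1) (expand_solS hO (nab D1 x x)).
  rewrite (solSC x (nab _ _ _)) (expand_solS hO (nab D1 x n)) !dots !dO.
  by rewrite (solSC y x) -/(solS n n); ring.
- rewrite (nab_solS y _ _ hD2) (expand_solS hO (nab D2 y y)).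
  rewrite (solSC y (nab _ _ _)) (expand_solS hO (nab D2 y n)) !dots !dO.
  by rewrite -/(solS n n); ring.
- exact: (solS_tr hO).
- have := solS_sqr hO n; rewrite nn !expr2 => e.
  by rewrite -/(solS n n) e; ring.
- exact: (solS_third hO n).
Qed.

End MovingFrame.

(** * The surface in coordinates *)

Lemma sum2 (C : nmodType) (F : 'I_2 -> C) :
  \sum_(i < 2) F i = F ord0 + F ord_max.
Proof.
by rewrite !big_ord_recl big_ord0 addr0; congr (_ + F _); apply/val_inj.
Qed.

Lemma ord2E (i : 'I_2) : i = ord0 \/ i = ord_max.
Proof. by case: i => [[|[|//]] hi]; [left|right]; exact: val_inj. Qed.

Section Coordinates.
Variables (C : comPzRingType) (half : C) (pd : 'I_2 -> C -> C).
Hypotheses (hhalf : half + half = 1) (hpd : forall i, derivation (pd i)).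
Hypothesis pdC : forall i j c, pd i (pd j c) = pd j (pd i c).
(* [P i] is the image of d_i under the differential of the immersion, [nn] the
   normal, both in the frame (E1, E2, E3); [X] is the orthonormal frame. *)
Variables (P : 'I_2 -> C * C * C) (nn : C * C * C) (X : 'I_2 -> 'I_2 -> C).
Hypothesis hP : nab (pd ord0) (P ord0) (P ord_max)
  = nab (pd ord_max) (P ord_max) (P ord0).
Hypothesis hX : forall a b,
  \sum_(i < 2) \sum_(j < 2) X a i * dot (P i) (P j) * X b j = (a == b)%:R.
Hypothesis hnn : dot nn nn = 1.
Hypothesis hnP : forall i, dot nn (P i) = 0.

Notation i0 := (ord0 : 'I_2).
Notation i1 := (ord_max : 'I_2).

(** The differential of the immersion, on coordinate components. *)
Definition lin (y : 'I_2 -> C) : C * C * C :=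
  (y i0 * (P i0).1.1 + y i1 * (P i1).1.1, y i0 * (P i0).1.2 + y i1 * (P i1).1.2,
   y i0 * (P i0).2 + y i1 * (P i1).2).

Definition frm (a : 'I_2) : C * C * C := lin (X a).

Definition dfr (a : 'I_2) (c : C) : C := X a i0 * pd i0 c + X a i1 * pd i1 c.

Definition nabP i v := nab (pd i) (P i) v.

(** The components of d_i in the frame, that is the dual coframe; this matrix is inverse to [X]. *)
Definition cofr (i c : 'I_2) : C := dot (P i) (frm c).

Lemma dfr_der a : derivation (dfr a).
Proof.
split=> x y; rewrite /dfr; first by rewrite !(derD (hpd _)); ring.
by rewrite !(derM (hpd _)); ring.
Qed.

Lemma dot_linl y v : dot (lin y) v = y i0 * dot (P i0) v + y i1 * dot (P i1) v.
Proof. by rewrite /dot /lin /=; ring. Qed.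

Lemma dot_linr y v : dot v (lin y) = y i0 * dot v (P i0) + y i1 * dot v (P i1).
Proof. by rewrite /dot /lin /=; ring. Qed.

Lemma dot_frm a b : dot (frm a) (frm b) = (a == b)%:R.
Proof. by rewrite -hX !sum2 /frm dot_linl !dot_linr; ring. Qed.

Lemma frm_ortho : orthonormal3 (frm i0) (frm i1) nn.
Proof.
split; split; rewrite ?dot_frm ?hnn //; rewrite /frm dotC dot_linr !hnP; ring.
Qed.

Lemma nab_frm a v w : dot (nab (dfr a) (frm a) v) w
  = X a i0 * dot (nabP i0 v) w + X a i1 * dot (nabP i1 v) w.
Proof. by rewrite /dot /nabP /nab /dfr /frm /lin /=; ring. Qed.

Lemma cofr_frame a c : X a i0 * cofr i0 c + X a i1 * cofr i1 c = (a == c)%:R.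
Proof. by rewrite -dot_frm {1}/frm dot_linl. Qed.

Lemma frame_cofr i j : cofr i i0 * X i0 j + cofr i i1 * X i1 j = (i == j)%:R.
Proof.
have XY : (\matrix_(a, k) X a k) *m (\matrix_(k, c) cofr k c) = 1%:M.
  by apply/matrixP => a c; rewrite !mxE sum2 !mxE cofr_frame.
by have /matrixP/(_ i j) := mulmx1C XY; rewrite !mxE sum2 !mxE.
Qed.

(** The coordinate components of [X0, X1]. *)
Definition brk (j : 'I_2) : C := dfr i0 (X i1 j) - dfr i1 (X i0 j).

(* The connection coefficients of the frame, nabla_X0 X0 = fra X1 and
   nabla_X1 X0 = frb X1, read off [X0, X1] = - fra X0 - frb X1. *)
Definition fra : C := - (brk i0 * cofr i0 i0 + brk i1 * cofr i1 i0).
Definition frb : C := - (brk i0 * cofr i0 i1 + brk i1 * cofr i1 i1).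

Lemma brkE j : dfr i0 (X i1 j) = dfr i1 (X i0 j) - fra * X i0 j - frb * X i1 j.
Proof.
(* Replacing the Kronecker symbols by [frame_cofr] passes from coordinate to frame components; the
   same device recurs below. *)
transitivity (dfr i1 (X i0 j) + (brk i0 * (i0 == j)%:R + brk i1 * (i1 == j)%:R)).
  by have [->|->] := ord2E j; rewrite /brk /=; ring.
by rewrite -!frame_cofr /fra /frb; ring.
Qed.

Lemma dfrC c : dfr i0 (dfr i1 c) = dfr i1 (dfr i0 c) - fra * dfr i0 c - frb * dfr i1 c.
Proof.
have := (brkE i0, brkE i1).
rewrite /dfr; move: fra frb => a b [e0 e1]; rewrite !(derE (hpd _)) (pdC i1 i0 c).
apply: subr0_eq.
(* The second derivatives of c cancel, leaving the two components of the bracket relation times the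
   partial derivatives of c. *)
transitivity (
  (X i0 i0 * pd i0 (X i1 i0) + X i0 i1 * pd i1 (X i1 i0)
   - (X i1 i0 * pd i0 (X i0 i0) + X i1 i1 * pd i1 (X i0 i0)
      - a * X i0 i0 - b * X i1 i0)) * pd i0 c
  + (X i0 i0 * pd i0 (X i1 i1) + X i0 i1 * pd i1 (X i1 i1)
   - (X i1 i0 * pd i0 (X i0 i1) + X i1 i1 * pd i1 (X i0 i1)
      - a * X i0 i1 - b * X i1 i1)) * pd i1 c); first by ring.
by rewrite e0 e1; ring.
Qed.

Lemma nabP_sym i j : nabP i (P j) = nabP j (P i).
Proof.
by have [->|->] := ord2E i; have [->|->] := ord2E j; rewrite // /nabP hP.
Qed.

(** Leibniz' rule carries the symmetry [nabP_sym] from the coordinate fields to the frame; the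
    derivatives of the coefficients give the bracket. *)
Lemma frm_torsion w : dot (nab (dfr i0) (frm i0) (frm i1)) w
  = dot (nab (dfr i1) (frm i1) (frm i0)) w - fra * dot (frm i0) w - frb * dot (frm i1) w.
Proof.
have nab_lin i y v : dot (nabP i (lin y)) v = pd i (y i0) * dot (P i0) v
   + pd i (y i1) * dot (P i1) v + y i0 * dot (nabP i (P i0)) v
   + y i1 * dot (nabP i (P i1)) v.
  by rewrite /nabP /nab /lin /dot /= !(derE (hpd _)); ring.
rewrite !nab_frm /frm !nab_lin !dot_linl (nabP_sym i1 i0).
have := (brkE i0, brkE i1); rewrite /dfr; move: fra frb => a b [e0 e1].
apply: subr0_eq.
transitivity (
  (X i0 i0 * pd i0 (X i1 i0) + X i0 i1 * pd i1 (X i1 i0)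
   - (X i1 i0 * pd i0 (X i0 i0) + X i1 i1 * pd i1 (X i0 i0)
      - a * X i0 i0 - b * X i1 i0)) * dot (P i0) w
  + (X i0 i0 * pd i0 (X i1 i1) + X i0 i1 * pd i1 (X i1 i1)
   - (X i1 i0 * pd i0 (X i0 i1) + X i1 i1 * pd i1 (X i0 i1)
      - a * X i0 i1 - b * X i1 i1)) * dot (P i1) w); first by ring.
by rewrite e0 e1; ring.
Qed.

Lemma dot_ext (u v : C * C * C) : (forall w, dot u w = dot v w) -> u = v.
Proof.
move=> uv; have := (uv (1, 0, 0), uv (0, 1, 0), uv (0, 0, 1)).
rewrite /dot /= !(mulr0, mulr1, addr0, add0r).
by case: u v {uv} => [[? ?] ?] [[? ?] ?] /= [[-> ->] ->].
Qed.

Lemma frm_torsion3 : nab (dfr i0) (frm i0) (frm i1)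
  = ((nab (dfr i1) (frm i1) (frm i0)).1.1 - fra * (frm i0).1.1 - frb * (frm i1).1.1,
     (nab (dfr i1) (frm i1) (frm i0)).1.2 - fra * (frm i0).1.2 - frb * (frm i1).1.2,
     (nab (dfr i1) (frm i1) (frm i0)).2 - fra * (frm i0).2 - frb * (frm i1).2).
Proof. by apply: dot_ext => w; rewrite frm_torsion /dot /nab /=; ring. Qed.

Lemma two_inj (c : C) : c + c = 0 -> c = 0.
Proof. by move=> cc; rewrite -[c]mul1r -hhalf mulrDl -mulrDr cc mulr0. Qed.

(** * Metric, connection and differential operators *)

Definition metC i j : C := dot (P i) (P j).
(** The inverse Gram matrix as the sum of the squares of the frame vectors, an expression without
    division. *)
Definition ginvC i j : C := X i0 i * X i0 j + X i1 i * X i1 j.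
Definition chrC k i j : C := half * \sum_(l < 2) ginvC k l *
  (pd i (metC j l) + pd j (metC i l) - pd l (metC i j)).
Definition covC (x y : 'I_2 -> C) k : C :=
  \sum_(i < 2) x i * (pd i (y k) + \sum_(j < 2) chrC k i j * y j).
Definition delC (i j : 'I_2) : C := (j == i)%:R.
Definition divC y : C := \sum_(i < 2) covC (delC i) y i.
Definition gradC f i : C := \sum_(j < 2) ginvC i j * pd j f.
Definition innC (x y : 'I_2 -> C) : C :=
  \sum_(j < 2) (\sum_(i < 2) x i * metC i j) * y j.

Lemma ginv_cofr l c : \sum_(k < 2) ginvC k l * cofr k c = X c l.
Proof.
have := (cofr_frame i0 c, cofr_frame i1 c); rewrite sum2 /ginvC => -[e0 e1].
transitivity (X i0 l * (X i0 i0 * cofr i0 c + X i0 i1 * cofr i1 c)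
  + X i1 l * (X i1 i0 * cofr i0 c + X i1 i1 * cofr i1 c)); first by ring.
by rewrite e0 e1; have [->|->] := ord2E c; rewrite /=; ring.
Qed.

Lemma metC_ginv i j : \sum_(k < 2) metC i k * ginvC k j = (i == j)%:R.
Proof.
rewrite -frame_cofr sum2 /cofr /frm !dot_linr /metC /ginvC; ring.
Qed.

(** Koszul's argument: after expanding the derivatives of the metric, the symmetry of [nabP] leaves
    twice one term. The induced connection is thus the tangent part of the ambient one. *)
Lemma chrCE k i j : chrC k i j = \sum_(l < 2) ginvC k l * dot (nabP i (P j)) (P l).
Proof.
rewrite /chrC mulr_sumr; apply: eq_bigr => l _.
rewrite /metC (nab_dot (P i) _ _ (hpd i)) (nab_dot (P j) _ _ (hpd j)).
rewrite (nab_dot (P l) _ _ (hpd l)) -!/(nabP _ _) (nabP_sym j i) (nabP_sym l).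
rewrite (nabP_sym l) !(dotC (P _)).
transitivity ((half + half) * (ginvC k l * dot (nabP i (P j)) (P l))).
  ring.
by rewrite hhalf mul1r.
Qed.

Lemma chrC_cofr i j c :
  \sum_(k < 2) chrC k i j * cofr k c = dot (nabP i (P j)) (frm c).
Proof.
under eq_bigr do rewrite chrCE mulr_suml.
rewrite exchange_big /=.
transitivity (\sum_(l < 2) dot (nabP i (P j)) (P l) * X c l).
  apply: eq_bigr => l _; rewrite -ginv_cofr mulr_sumr.
  by apply: eq_bigr => k _; ring.
by rewrite sum2 /frm dot_linr; ring.
Qed.

(** The coordinate components of y0 X0 + y1 X1. The lemmas ending in [_ffld] translate each
    operation to frame components. *)
Definition ffld (y0 y1 : C) (k : 'I_2) : C := y0 * X i0 k + y1 * X i1 k.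

Lemma ffld_cofr (v : 'I_2 -> C) k :
  v k = ffld (\sum_(l < 2) v l * cofr l i0) (\sum_(l < 2) v l * cofr l i1) k.
Proof.
transitivity (v i0 * (i0 == k)%:R + v i1 * (i1 == k)%:R).
  by have [->|->] := ord2E k; rewrite /=; ring.
by rewrite -!frame_cofr /ffld !sum2; ring.
Qed.

Lemma eq_covC x y y' : y =1 y' -> covC x y =1 covC x y'.
Proof.
move=> yy k; apply: eq_bigr => i _; rewrite yy; congr (_ * (_ + _)).
by apply: eq_bigr => j _; rewrite yy.
Qed.

(* The connection form: nabla_i X0 = conn i X1, nabla_i X1 = - conn i X0. *)
Definition conn i : C := fra * cofr i i0 + frb * cofr i i1.

Lemma nabP_frame i v w : dot (nabP i v) w =
  cofr i i0 * dot (nab (dfr i0) (frm i0) v) w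
  + cofr i i1 * dot (nab (dfr i1) (frm i1) v) w.
Proof.
rewrite !nab_frm.
transitivity ((i == i0)%:R * dot (nabP i0 v) w + (i == i1)%:R * dot (nabP i1 v) w).
  by have [->|->] := ord2E i; rewrite /=; ring.
by rewrite -!frame_cofr; ring.
Qed.

Let T1 := congr1 (fun v => v.1.1) frm_torsion3.
Let T2 := congr1 (fun v => v.1.2) frm_torsion3.
Let T3 := congr1 snd frm_torsion3.

Lemma nabP_frm i : dot (nabP i (frm i0)) (frm i1) = conn i.
Proof.
rewrite nabP_frame (frame_conn1 (dfr_der _) (dfr_der _) two_inj frm_ortho T1 T2 T3).
rewrite (frame_conn2 (dfr_der _) two_inj frm_ortho T1 T2 T3) /conn; ring.
Qed.

Lemma nabP_ffld i y0 y1 :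
  let v := lin (ffld y0 y1) in
  dot (nabP i v) (frm i0) = pd i y0 - conn i * y1 /\
  dot (nabP i v) (frm i1) = pd i y1 + conn i * y0.
Proof.
have e w : dot (nabP i (lin (ffld y0 y1))) w = pd i y0 * dot (frm i0) w
    + pd i y1 * dot (frm i1) w + y0 * dot (nabP i (frm i0)) w
    + y1 * dot (nabP i (frm i1)) w.
  by rewrite /nabP /nab /lin /frm /lin /ffld /dot /= !(derE (hpd _)); ring.
have self c : dot (nabP i (frm c)) (frm c) = 0.
  by rewrite (nab_self two_inj) // dot_frm eqxx.
have skew : dot (nabP i (frm i1)) (frm i0) = - conn i.
  by rewrite -nabP_frm /nabP (nab_skew _ (hpd i)) // dot_frm (der0 (hpd i)).
by move=> v; rewrite !e !dot_frm !self skew nabP_frm /=; split; ring.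
Qed.

(** By [chrC_cofr] the frame components are those of the ambient derivative, which [nabP_ffld] gives
    through the connection form. *)
Lemma covC_ffld x y0 y1 k : covC x (ffld y0 y1) k =
  ffld (\sum_(i < 2) x i * (pd i y0 - conn i * y1))
       (\sum_(i < 2) x i * (pd i y1 + conn i * y0)) k.
Proof.
rewrite [LHS](ffld_cofr (covC x (ffld y0 y1))).
have e c : \sum_(l < 2) covC x (ffld y0 y1) l * cofr l c
    = \sum_(i < 2) x i * dot (nabP i (lin (ffld y0 y1))) (frm c).
  rewrite /covC; under eq_bigr do rewrite mulr_suml.
  rewrite exchange_big; apply: eq_bigr => i _.
  transitivity (x i * (\sum_(l < 2) pd i (ffld y0 y1 l) * cofr l c
     + \sum_(j < 2) (\sum_(l < 2) chrC l i j * cofr l c) * ffld y0 y1 j)).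
    by rewrite !sum2; ring.
  under [X in _ + X]eq_bigr do rewrite chrC_cofr.
  rewrite !sum2 /cofr; congr (_ * _).
  by rewrite /nabP /nab /lin /dot /= !(derE (hpd _)); ring.
have nf i := nabP_ffld i y0 y1.
rewrite !e; congr (ffld _ _ k); apply: eq_bigr => i _.
  by rewrite (nf i).1.
by rewrite (nf i).2.
Qed.

Lemma pd_dfr i c : pd i c = cofr i i0 * dfr i0 c + cofr i i1 * dfr i1 c.
Proof.
transitivity ((i == i0)%:R * pd i0 c + (i == i1)%:R * pd i1 c).
  by have [->|->] := ord2E i; rewrite /=; ring.
by rewrite -!frame_cofr /dfr; ring.
Qed.

Lemma conn_frame0 : X i0 i0 * conn i0 + X i0 i1 * conn i1 = fra.
Proof.
have := (cofr_frame i0 i0, cofr_frame i0 i1); rewrite /conn => -[e0 e1].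
transitivity (fra * (X i0 i0 * cofr i0 i0 + X i0 i1 * cofr i1 i0)
  + frb * (X i0 i0 * cofr i0 i1 + X i0 i1 * cofr i1 i1)); first by ring.
by rewrite e0 e1 /=; ring.
Qed.

Lemma conn_frame1 : X i1 i0 * conn i0 + X i1 i1 * conn i1 = frb.
Proof.
have := (cofr_frame i1 i0, cofr_frame i1 i1); rewrite /conn => -[e0 e1].
transitivity (fra * (X i1 i0 * cofr i0 i0 + X i1 i1 * cofr i1 i0)
  + frb * (X i1 i0 * cofr i0 i1 + X i1 i1 * cofr i1 i1)); first by ring.
by rewrite e0 e1 /=; ring.
Qed.

Lemma eq_divC y y' : y =1 y' -> divC y = divC y'.
Proof. by move=> yy; apply: eq_bigr => i _; exact: eq_covC. Qed.

Lemma divC_ffld y0 y1 :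
  divC (ffld y0 y1) = fdiv (dfr i0) (dfr i1) fra frb y0 y1.
Proof.
rewrite /divC !sum2 !covC_ffld !sum2 /ffld /delC /= /fdiv.
by rewrite -conn_frame0 -conn_frame1 /dfr; ring.
Qed.

Lemma covC_frame0 y0 y1 k : covC (X i0) (ffld y0 y1) k =
  ffld (dfr i0 y0 - fra * y1) (dfr i0 y1 + fra * y0) k.
Proof.
by rewrite covC_ffld !sum2 -conn_frame0 /dfr; congr (ffld _ _ k); ring.
Qed.

Lemma covC_frame1 y0 y1 k : covC (X i1) (ffld y0 y1) k =
  ffld (dfr i1 y0 - frb * y1) (dfr i1 y1 + frb * y0) k.
Proof.
by rewrite covC_ffld !sum2 -conn_frame1 /dfr; congr (ffld _ _ k); ring.
Qed.

Lemma innCE x y : innC x y = dot (lin x) (lin y).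
Proof. by rewrite /innC !sum2 dot_linl !dot_linr /metC; ring. Qed.

Lemma innC_ffld x0 x1 y0 y1 :
  innC (ffld x0 x1) (ffld y0 y1) = x0 * y0 + x1 * y1.
Proof.
have e z0 z1 w : dot (lin (ffld z0 z1)) w = z0 * dot (frm i0) w + z1 * dot (frm i1) w.
  by rewrite /frm !dot_linl /ffld; ring.
by rewrite innCE e dotC (dotC _ (lin _)) !e !dot_frm /=; ring.
Qed.

Lemma eq_innC x x' y y' : x =1 x' -> y =1 y' -> innC x y = innC x' y'.
Proof. by move=> xx yy; rewrite /innC !sum2 !xx !yy. Qed.

Lemma delC_ffld i : delC i =1 ffld (cofr i i0) (cofr i i1).
Proof. by move=> j; rewrite /delC eq_sym -frame_cofr. Qed.

Lemma gradC_ffld f : gradC f =1 ffld (dfr i0 f) (dfr i1 f).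
Proof. by move=> i; rewrite /gradC sum2 /ginvC /ffld /dfr; ring. Qed.

(** * Cartan's structure equations and the Gaussian curvature *)

Definition detF : C := X i0 i0 * X i1 i1 - X i0 i1 * X i1 i0.
Definition detY : C := cofr i0 i0 * cofr i1 i1 - cofr i0 i1 * cofr i1 i0.

Lemma detYF : detY * detF = 1.
Proof.
have := (frame_cofr i0 i0, frame_cofr i0 i1, frame_cofr i1 i0, frame_cofr i1 i1).
move=> [[[/= e00 e01] e10] e11].
transitivity ((cofr i0 i0 * X i0 i0 + cofr i0 i1 * X i1 i0)
     * (cofr i1 i0 * X i0 i1 + cofr i1 i1 * X i1 i1)
   - (cofr i0 i0 * X i0 i1 + cofr i0 i1 * X i1 i1)
     * (cofr i1 i0 * X i0 i0 + cofr i1 i1 * X i1 i0)).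
  by rewrite /detY /detF; ring.
by rewrite e00 e01 e10 e11; ring.
Qed.

(** The first structure equation, with [detY] the area form on (d_0, d_1). Differentiating the
    duality relations gives the exterior derivative of the coframe on (X0, X1) as minus the coframe
    on [X0, X1]; the factor [detF] converts between the two bases. *)
Lemma dcofr c : pd i0 (cofr i1 c) - pd i1 (cofr i0 c)
  = detY * ((c == i0)%:R * fra + (c == i1)%:R * frb).
Proof.
suff e : detF * (pd i0 (cofr i1 c) - pd i1 (cofr i0 c))
    = (c == i0)%:R * fra + (c == i1)%:R * frb by rewrite -e mulrA detYF mul1r.
have e0 := congr1 (dfr i0) (cofr_frame i1 c).
have e1 := congr1 (dfr i1) (cofr_frame i0 c).
have d0 a (b : bool) : dfr a b%:R = 0.
  by case: b; rewrite /= ?(der1 (dfr_der _)) ?(der0 (dfr_der _)).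
rewrite d0 (derD (dfr_der _)) 2!(derM (dfr_der _)) in e0.
rewrite d0 (derD (dfr_der _)) 2!(derM (dfr_der _)) in e1.
have e2 : - (brk i0 * cofr i0 c + brk i1 * cofr i1 c)
    = (c == i0)%:R * fra + (c == i1)%:R * frb.
  by have [->|->] := ord2E c; rewrite /fra /frb /=; ring.
rewrite -e2 /brk; apply: subr0_eq; move: e0 e1.
set z0 := (Z in Z = 0 -> _) => e0; set z1 := (Z in Z = 0 -> _) => e1.
transitivity (z0 - z1); last by rewrite e0 e1 subrr.
by rewrite /z0 /z1 /detF /dfr; ring.
Qed.

Definition gaussK : C := dfr i1 fra - dfr i0 frb - fra * fra - frb * frb.

(** The second structure equation: the connection form has exterior derivative - K times the area
    form. *)
Lemma dconn : pd i0 (conn i1) - pd i1 (conn i0) = - detY * gaussK.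
Proof.
have := (dcofr i0, dcofr i1) => -[/= e0 e1].
transitivity (fra * (pd i0 (cofr i1 i0) - pd i1 (cofr i0 i0))
  + frb * (pd i0 (cofr i1 i1) - pd i1 (cofr i0 i1))
  + (pd i0 fra * cofr i1 i0 - pd i1 fra * cofr i0 i0)
  + (pd i0 frb * cofr i1 i1 - pd i1 frb * cofr i0 i1)).
  by rewrite /conn 2!(derD (hpd _)) 4!(derM (hpd _)); ring.
by rewrite e0 e1 !(pd_dfr _ fra) !(pd_dfr _ frb) /gaussK /detY; ring.
Qed.

Definition curvC k : C := covC (delC i0) (covC (delC i1) (delC i1)) k
  - covC (delC i1) (covC (delC i0) (delC i1)) k.

Lemma gaussC :
  innC curvC (delC i0) = gaussK * (metC i0 i0 * metC i1 i1 - metC i0 i1 * metC i1 i0).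
Proof.
have met i j : metC i j = cofr i i0 * cofr j i0 + cofr i i1 * cofr j i1.
  rewrite -innC_ffld -(eq_innC (delC_ffld i) (delC_ffld j)) innCE.
  rewrite dot_linl !dot_linr /delC /metC.
  by have [->|->] := ord2E i; have [->|->] := ord2E j; rewrite /=; ring.
have cv i : covC (delC i) (delC i1) =1
    ffld (pd i (cofr i1 i0) - conn i * cofr i1 i1)
         (pd i (cofr i1 i1) + conn i * cofr i1 i0).
  move=> k; rewrite (eq_covC _ (delC_ffld i1)) covC_ffld !sum2 /delC.
  by congr (ffld _ _ k); have [->|->] := ord2E i; rewrite /=; ring.
(* The curvature acts as a quarter turn times the exterior derivative of the connection form.
   Pairing with d_0 gives a second factor [detY], and [detY] squared is the Gram determinant. *)
have cE : curvC =1 ffld (- (pd i0 (conn i1) - pd i1 (conn i0)) * cofr i1 i1)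
    ((pd i0 (conn i1) - pd i1 (conn i0)) * cofr i1 i0).
  move=> k; rewrite /curvC (eq_covC _ (cv i1)) (eq_covC _ (cv i0)) !covC_ffld.
  rewrite !sum2 /delC /=.
  have derBM i x y z : pd i (x - y * z) = pd i x - pd i y * z - y * pd i z.
    by rewrite !(derE (hpd i)); ring.
  have derDM i x y z : pd i (x + y * z) = pd i x + pd i y * z + y * pd i z.
    by rewrite !(derE (hpd i)); ring.
  by rewrite /ffld !derBM !derDM !(pdC i1 i0); ring.
by rewrite (eq_innC cE (delC_ffld i0)) innC_ffld dconn !met /detY; ring.
Qed.

(** * The shape operator in the frame *)

Definition shpC i j : C := \sum_(l < 2) (- dot (nabP i nn) (P l)) * ginvC l j.
Definition appC y j : C := \sum_(i < 2) y i * shpC i j.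
Definition tanC j : C := \sum_(l < 2) (P l).2 * ginvC l j.
Definition trC : C := \sum_(i < 2) shpC i i.
Definition tr2C : C := \sum_(i < 2) \sum_(j < 2) shpC i j * shpC j i.
Definition covshpC a b k : C :=
  covC (X a) (appC (X b)) k - appC (covC (X a) (X b)) k.

Definition sff a b : C := - dot (nab (dfr a) (frm a) nn) (frm b).

Lemma shpC_ffld i : shpC i =1
  ffld (- dot (nabP i nn) (frm i0)) (- dot (nabP i nn) (frm i1)).
Proof. by move=> j; rewrite /shpC sum2 /frm !dot_linr /ginvC /ffld; ring. Qed.

Lemma sff_sym : sff i1 i0 = sff i0 i1.
Proof.
by rewrite /sff (shape_sym (dfr_der _) (dfr_der _) frm_ortho T1 T2 T3).
Qed.

Lemma appC_ffld y0 y1 : appC (ffld y0 y1) =1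
  ffld (y0 * sff i0 i0 + y1 * sff i0 i1) (y0 * sff i0 i1 + y1 * sff i1 i1).
Proof.
move=> j; rewrite -{1}sff_sym /appC sum2 !shpC_ffld /sff !nab_frm /ffld; ring.
Qed.

Lemma eq_appC y y' : y =1 y' -> appC y =1 appC y'.
Proof. by move=> yy j; apply: eq_bigr => i _; rewrite yy. Qed.

Lemma tanC_ffld : tanC =1 ffld (frm i0).2 (frm i1).2.
Proof. by move=> j; rewrite /tanC sum2 /ginvC /ffld /frm /lin /=; ring. Qed.

Lemma trCE : trC = sff i0 i0 + sff i1 i1.
Proof. by rewrite /trC sum2 !shpC_ffld /ffld /sff !nab_frm; ring. Qed.

Lemma tr2CE : tr2C = sff i0 i0 * sff i0 i0 + 2 * (sff i0 i1 * sff i0 i1)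
  + sff i1 i1 * sff i1 i1.
Proof.
transitivity (sff i0 i0 * sff i0 i0 + 2 * (sff i0 i1 * sff i1 i0)
  + sff i1 i1 * sff i1 i1); last by rewrite sff_sym.
by rewrite /tr2C !sum2 !shpC_ffld /ffld /sff !nab_frm; ring.
Qed.

Lemma frame_ffld a : X a =1 ffld (a == i0)%:R (a == i1)%:R.
Proof. by move=> j; rewrite /ffld; have [->|->] := ord2E a; rewrite /=; ring. Qed.

(** The components of nabla A are derivatives of the second fundamental form corrected by the
    connection coefficients; the symmetric mixed entry counts twice. *)
Lemma covshpC_norm : \sum_(a < 2) \sum_(b < 2) innC (covshpC a b) (covshpC a b) =
  (dfr i0 (sff i0 i0) - 2 * fra * sff i0 i1) ^+ 2
  + 2 * (dfr i0 (sff i0 i1) + fra * (sff i0 i0 - sff i1 i1)) ^+ 2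
  + (dfr i0 (sff i1 i1) + 2 * fra * sff i0 i1) ^+ 2
  + ((dfr i1 (sff i0 i0) - 2 * frb * sff i0 i1) ^+ 2
    + 2 * (dfr i1 (sff i0 i1) + frb * (sff i0 i0 - sff i1 i1)) ^+ 2
    + (dfr i1 (sff i1 i1) + 2 * frb * sff i0 i1) ^+ 2).
Proof.
(* This order of indices never produces [sff i1 i0], so only three entries occur. *)
have appX b : appC (X b) =1 ffld (sff i0 b) (sff b i1).
  move=> k; rewrite (eq_appC (frame_ffld b)) appC_ffld.
  by have [->|->] := ord2E b; rewrite /ffld /=; ring.
have cst a (b : bool) : dfr a b%:R = 0.
  by case: b; rewrite /= ?(der1 (dfr_der _)) ?(der0 (dfr_der _)).
have c0 b : covshpC i0 b =1
    ffld (dfr i0 (sff i0 b) - fra * sff b i1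
          - (- fra * (b == i1)%:R * sff i0 i0 + fra * (b == i0)%:R * sff i0 i1))
         (dfr i0 (sff b i1) + fra * sff i0 b
          - (- fra * (b == i1)%:R * sff i0 i1 + fra * (b == i0)%:R * sff i1 i1)).
  move=> k; rewrite /covshpC (eq_covC _ (appX b)) covC_frame0.
  rewrite (eq_appC (eq_covC _ (frame_ffld b))) (eq_appC (covC_frame0 _ _)) appC_ffld.
  by rewrite !cst /ffld; ring.
have c1 b : covshpC i1 b =1
    ffld (dfr i1 (sff i0 b) - frb * sff b i1
          - (- frb * (b == i1)%:R * sff i0 i0 + frb * (b == i0)%:R * sff i0 i1))
         (dfr i1 (sff b i1) + frb * sff i0 b
          - (- frb * (b == i1)%:R * sff i0 i1 + frb * (b == i0)%:R * sff i1 i1)).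
  move=> k; rewrite /covshpC (eq_covC _ (appX b)) covC_frame1.
  rewrite (eq_appC (eq_covC _ (frame_ffld b))) (eq_appC (covC_frame1 _ _)) appC_ffld.
  by rewrite !cst /ffld; ring.
rewrite !sum2 !(eq_innC (c0 _) (c0 _)) !(eq_innC (c1 _) (c1 _)) !innC_ffld /=.
ring.
Qed.

(** All operations are moved to frame components, where the identity is [half] times
    [frame_simons]. *)
Theorem coord_simons (f := half * trC) (n := nn.2) :
  half * divC (gradC (tr2C + 2 * n ^+ 2)) =
    \sum_(a < 2) \sum_(b < 2) innC (covshpC a b) (covshpC a b)
    - 4 * innC (gradC f) (gradC f) - 2 * n * innC (gradC f) tanC
    + 2 * divC (appC (gradC f)) - 6 * divC (fun j => f * n * tanC j)
    + 2 * gaussK * (tr2C - 2 * f ^+ 2)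
    + 2 * n ^+ 2 * (tr2C + 2 * f ^+ 2 - 3)
    - 2 * innC (appC tanC) (appC tanC) - 2 * f * innC (appC tanC) tanC
    + 2 - 2 * (nn.1.2 ^+ 2 - nn.1.1 ^+ 2) ^+ 2.
Proof.
have hf : f + f = sff i0 i0 + sff i1 i1 by rewrite -mulrDl hhalf mul1r trCE.
have := @frame_simons C (dfr i0) (dfr i1) (dfr_der i0) (dfr_der i1) two_inj fra frb
  (frm i0) (frm i1) nn dfrC frm_ortho T1 T2 T3 f hf.
rewrite -/(sff i0 i0) -/(sff i0 i1) -/(sff i1 i1) -/gaussK => main.
have tA := fun k => etrans (eq_appC tanC_ffld k) (appC_ffld (frm i0).2 (frm i1).2 k).
rewrite covshpC_norm (eq_divC (gradC_ffld _)) divC_ffld.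
rewrite (eq_innC (gradC_ffld f) (gradC_ffld f)) innC_ffld.
rewrite (eq_innC (gradC_ffld f) tanC_ffld) innC_ffld.
rewrite (eq_divC (eq_appC (gradC_ffld f))) (eq_divC (appC_ffld _ _)) divC_ffld.
rewrite (eq_innC tA tA) innC_ffld (eq_innC tA tanC_ffld) innC_ffld.
have -> : divC (fun j => f * n * tanC j)
    = fdiv (dfr i0) (dfr i1) fra frb (f * n * (frm i0).2) (f * n * (frm i1).2).
  by rewrite -divC_ffld; apply: eq_divC => j; rewrite tanC_ffld /ffld; ring.
rewrite tr2CE expr2 main mulrA (_ : half * 2 = 1); last by rewrite mulr_natr mulr2n hhalf.
rewrite mul1r ![dfr _ f * sff _ _]mulrC !expr2.
by move: main hf => _ _; ring.
Qed.

End Coordinates.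

(** * Functions of class C^k *)

Lemma is_derive_line (R : realType) (V W : normedModType R) (f : V -> W)
    (u v : V) (x : R) (d : W) :
  is_derive (x *: v + u) v f d -> is_derive x 1 (fun h : R => f (h *: v + u)) d.
Proof.
move=> [df <-].
have E : (fun h : R => h^-1 *: ((f \o shift (x *: v + u)) (h *: v) - f (x *: v + u)))
   = (fun h : R => h^-1 *: (((fun h : R => f (h *: v + u)) \o shift x) (h *: 1)
        - f (x *: v + u))).
  by apply/funext => h /=; rewrite [_%:A]mulr1 scalerDl addrA.
by apply: DeriveDef; rewrite /derivable /derive -E.
Qed.

(** The one-variable chain rule on the line through u with direction v, so that a directional
    derivative of f is enough. *)
Lemma is_derive_comp_expR (R : realType) (V : normedModType R) (f : V -> R)
    (u v : V) (d : R) :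
  is_derive u v f d -> is_derive u v (expR \o f) (expR (f u) * d).
Proof.
move=> df.
have df0 : is_derive (0 : R) 1 (fun h : R => f (h *: v + u)) d.
  by apply: is_derive_line; rewrite scale0r add0r.
have := @is_derive1_comp _ expR _ 0 _ _ (is_derive_expR _) df0.
rewrite scale0r add0r => de.
case: de => de dE; apply: DeriveDef; first by apply/derivable1P; exact: de.
have E : (fun h : R => h^-1 *: (((expR \o f) \o shift u) (h *: v) - (expR \o f) u))
   = (fun h : R => h^-1 *: (((expR \o (fun h : R => f (h *: v + u))) \o shift 0)
       (h *: 1) - (expR \o (fun h : R => f (h *: v + u))) 0)).
  by apply/funext => h /=; rewrite [_%:A]mulr1 addr0 scale0r add0r.
by rewrite -dE /derive -E.
Qed.

Section CkTheory.
Variables (R : realType) (n : nat).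
Implicit Types (U : set 'rV[R]_n) (k : nat).

Lemma Ck_continuous (W : normedModType R) k U (f : 'rV[R]_n -> W) u :
  Ck k U f -> U u -> {for u, continuous f}.
Proof. by case: k => [|k] [fc _]; apply: fc. Qed.

Lemma Ck_derivable (W : normedModType R) k U (f : 'rV[R]_n -> W) i u :
  Ck k.+1 U f -> U u -> derivable f u (delta_mx 0 i).
Proof. by move=> [_ /(_ i)[df _]]; exact: df. Qed.

Lemma Ck_partial (W : normedModType R) k U (f : 'rV[R]_n -> W) i :
  Ck k.+1 U f -> Ck k U (partial i f).
Proof. by move=> [_ /(_ i)[]]. Qed.

Lemma near_eq_open (W : normedModType R) U (f g : 'rV[R]_n -> W) u :
  open U -> {in U, f =1 g} -> U u -> \near u, f u = g u.
Proof.
move=> oU fg Uu; near=> z; apply: fg; rewrite inE.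
by near: z; exact: open_nbhs_nbhs.
Unshelve. all: by end_near. Qed.

Lemma eq_partial (W : normedModType R) U (f g : 'rV[R]_n -> W) i :
  open U -> {in U, f =1 g} -> {in U, partial i f =1 partial i g}.
Proof.
move=> oU fg u; rewrite inE => Uu.
exact/near_eq_derive/(near_eq_open oU).
Qed.

Lemma eq_Ck (W : normedModType R) U k (f g : 'rV[R]_n -> W) :
  open U -> {in U, f =1 g} -> Ck k U f -> Ck k U g.
Proof.
move=> oU; elim: k f g => [|k IH] f g fg [fc fd]; split => //=.
- move=> u Uu; have fgu := near_eq_open oU fg Uu.
  rewrite /prop_for /continuous_at -(nbhs_singleton fgu).
  by apply: cvg_trans (fc u Uu); exact: near_eq_cvg fgu.
- move=> u Uu; have fgu := near_eq_open oU fg Uu.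
  rewrite /prop_for /continuous_at -(nbhs_singleton fgu).
  by apply: cvg_trans (fc u Uu); exact: near_eq_cvg fgu.
- move=> i; have [fd1 fd2] := fd i; split.
    by move=> u Uu; apply: near_eq_derivable (fd1 u Uu); exact: near_eq_open Uu.
  exact/(IH _ _ _ fd2)/eq_partial.
Qed.

Lemma Ck_cst (W : normedModType R) k U (c : W) :
  open U -> Ck k U (cst c : 'rV[R]_n -> W).
Proof.
move=> oU; elim: k c => [|k IH] c; split => //=; try by move=> u _; exact: cst_continuous.
move=> i; split=> [u _|]; first exact: derivable_cst.
have -> : partial i (cst c : 'rV[R]_n -> W) = cst 0.
  by apply/funext => u; rewrite /partial derive_cst.
exact: IH.
Qed.

Lemma Ck_add (W : normedModType R) k U (f g : 'rV[R]_n -> W) :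
  open U -> Ck k U f -> Ck k U g -> Ck k U (fun u => f u + g u).
Proof.
move=> oU; elim: k f g => [|k IH] f g hf hg; split => //=.
- by move=> u Uu; exact: (cvgD (Ck_continuous hf Uu) (Ck_continuous hg Uu)).
- by move=> u Uu; exact: (cvgD (Ck_continuous hf Uu) (Ck_continuous hg Uu)).
- move=> i; split=> [u Uu|].
    by apply: derivableD; [exact: Ck_derivable hf Uu|exact: Ck_derivable hg Uu].
  apply: eq_Ck (IH _ _ (Ck_partial i hf) (Ck_partial i hg)) => // u.
  rewrite inE => Uu; rewrite /partial -deriveD //.
    exact: Ck_derivable hf Uu.
  exact: Ck_derivable hg Uu.
Qed.

Lemma CkW (W : normedModType R) k U (f : 'rV[R]_n -> W) :
  Ck k.+1 U f -> Ck k U f.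
Proof.
elim: k f => [|k IH] f hf; split => //=; try by move=> u; exact: Ck_continuous hf.
move=> i; split => [u Uu|]; first exact: Ck_derivable hf Uu.
exact/IH/Ck_partial.
Qed.

Lemma partialM U (f g : 'rV[R]_n -> R) i u :
  Ck 1 U f -> Ck 1 U g -> U u ->
  partial i (fun u => f u * g u) u = partial i f u * g u + f u * partial i g u.
Proof.
move=> hf hg Uu; rewrite /partial [LHS]deriveM; last 2 first.
- exact: Ck_derivable hf Uu.
- exact: Ck_derivable hg Uu.
by rewrite addrC; congr (_ + _); rewrite [LHS]mulrC.
Qed.

Lemma Ck1 (W : normedModType R) k U (f : 'rV[R]_n -> W) : Ck k.+1 U f -> Ck 1 U f.
Proof. by elim: k => // k IH /CkW. Qed.

Lemma Ck_mul k U (f g : 'rV[R]_n -> R) :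
  open U -> Ck k U f -> Ck k U g -> Ck k U (fun u => f u * g u).
Proof.
move=> oU; elim: k f g => [|k IH] f g hf hg; split => //=.
- by move=> u Uu; exact: (cvgM (Ck_continuous hf Uu) (Ck_continuous hg Uu)).
- by move=> u Uu; exact: (cvgM (Ck_continuous hf Uu) (Ck_continuous hg Uu)).
- move=> i; split=> [u Uu|].
    by apply: derivableM; [exact: Ck_derivable hf Uu|exact: Ck_derivable hg Uu].
  have hd := Ck_add oU (IH _ _ (Ck_partial i hf) (CkW hg))
                    (IH _ _ (CkW hf) (Ck_partial i hg)).
  apply: eq_Ck hd => // u; rewrite inE => Uu.
  by rewrite (partialM _ (Ck1 hf) (Ck1 hg) Uu).
Qed.

Lemma Ck_opp k U (f : 'rV[R]_n -> R) :
  open U -> Ck k U f -> Ck k U (fun u => - f u).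
Proof.
move=> oU hf; have := Ck_mul oU (Ck_cst k (-1 : R) oU) hf.
by apply: eq_Ck => // u _; rewrite mulN1r.
Qed.

Lemma partial_expR U (f : 'rV[R]_n -> R) i u :
  Ck 1 U f -> U u ->
  partial i (expR \o f) u = expR (f u) * partial i f u.
Proof.
move=> hf Uu; have df := derivableP (Ck_derivable (i := i) hf Uu).
by have [_ <-] := is_derive_comp_expR df.
Qed.

Lemma Ck_expR k U (f : 'rV[R]_n -> R) :
  open U -> Ck k U f -> Ck k U (expR \o f).
Proof.
have cexp j g u : Ck j U g -> U u -> {for u, continuous (expR \o g)}.
  move=> hg Uu; apply: continuous_comp; first exact: (Ck_continuous hg Uu).
  exact: continuous_expR.
move=> oU; elim: k => [|k IH] hf; split => //=; try by move=> u; exact: cexp hf.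
move=> i; split=> [u Uu|].
  have df := derivableP (Ck_derivable (i := i) hf Uu).
  by have [] := is_derive_comp_expR df.
apply: eq_Ck (Ck_mul oU (IH (CkW hf)) (Ck_partial i hf)) => // u.
by rewrite inE => Uu; rewrite (partial_expR _ (Ck1 hf) Uu).
Qed.

Lemma partial_coef (m p : nat) (f : 'rV[R]_n -> 'M[R]_(m, p)) i a b u :
  derivable f u (delta_mx 0 i) ->
  partial i (fun v => f v a b) u = partial i f u a b.
Proof. by move=> df; rewrite /partial derive_mx // mxE. Qed.

Lemma Ck_coef k U (m p : nat) (f : 'rV[R]_n -> 'M[R]_(m, p)) a b :
  open U -> Ck k U f -> Ck k U (fun v => f v a b).
Proof.
move=> oU; elim: k f => [|k IH] f hf; split => //=.
- move=> u Uu.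
  exact: (continuous_comp (Ck_continuous hf Uu) (@coord_continuous R _ _ a b _)).
- move=> u Uu.
  exact: (continuous_comp (Ck_continuous hf Uu) (@coord_continuous R _ _ a b _)).
- move=> i; split=> [u Uu|].
    by have /derivable_mxP := Ck_derivable (i := i) hf Uu; apply.
  apply: eq_Ck (IH _ (Ck_partial i hf)) => // u; rewrite inE => Uu.
  by rewrite -(partial_coef a b (Ck_derivable (i := i) hf Uu)).
Qed.

End CkTheory.

(** * Symmetry of second derivatives *)

Section Schwarz.
Variables (R : realType) (V : normedModType R).
Implicit Types (f : V -> R) (u v w : V).

Lemma MVT_derivable (g dg : R -> R) (d : R) : 0 < d ->
  (forall s, 0 <= s <= d -> is_derive s 1 g (dg s)) ->
  exists2 s, 0 <= s <= d & g d - g 0 = d * dg s.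
Proof.
move=> d0 dgE; have [s||s sd e] := @MVT R g dg 0 d d0.
- by rewrite in_itv /= => /andP[s0 sd]; apply: dgE; rewrite !ltW.
- apply: derivable_within_continuous => s; rewrite in_itv /= => sd.
  by case: (dgE s sd).
exists s; first by move: sd; rewrite in_itv /= => /andP[s0 sd]; rewrite !ltW.
by rewrite e subr0 mulrC.
Qed.

Lemma MVT_direction f u v (d : R) : 0 < d ->
  (forall s, 0 <= s <= d -> derivable f (s *: v + u) v) ->
  exists2 s, 0 <= s <= d & f (d *: v + u) - f u = d * 'D_v f (s *: v + u).
Proof.
move=> d0 df.
have [s sd|s sd] := @MVT_derivable (fun h => f (h *: v + u))
  (fun s => 'D_v f (s *: v + u)) d d0.
  exact/is_derive_line/derivableP/df.
by rewrite scale0r add0r => e; exists s.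
Qed.

(** The second difference over a parallelogram: the mean value theorem is applied along v to the
    difference of f in w, then along w to the derivative. *)
Lemma MVT_mixed f u v w (d : R) : 0 < d ->
  (forall s t, 0 <= s <= d -> 0 <= t <= d ->
     derivable f (s *: v + (t *: w + u)) v) ->
  (forall s t, 0 <= s <= d -> 0 <= t <= d ->
     derivable ('D_v f) (s *: v + (t *: w + u)) w) ->
  exists s t, [/\ 0 <= s <= d, 0 <= t <= d &
    f (d *: v + (d *: w + u)) - f (d *: v + u) - f (d *: w + u) + f u
    = d * (d * 'D_w ('D_v f) (s *: v + (t *: w + u)))].
Proof.
move=> d0 df ddf; have dd : 0 <= d <= d by apply/andP; split; [exact: ltW|exact: lexx].
have d00 : 0 <= (0 : R) <= d by apply/andP; split; [exact: lexx|exact: ltW].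
have df0 s : 0 <= s <= d -> derivable f (s *: v + u) v.
  by move=> sd; have := df s 0 sd d00; rewrite scale0r add0r.
have [s sd|s sd] := @MVT_derivable
  ((fun h : R => f (h *: v + (d *: w + u))) - (fun h : R => f (h *: v + u)))
  (fun s => 'D_v f (s *: v + (d *: w + u)) - 'D_v f (s *: v + u)) d d0.
  by apply: is_deriveB; apply/is_derive_line/derivableP; [exact: df|exact: df0].
have [t td|t td] := @MVT_direction ('D_v f) (s *: v + u) w d d0.
  by rewrite addrCA; exact: ddf.
rewrite [in X in _ = d * X]addrCA [_ *: v + (t *: w + u)]addrCA => e1 e2.
exists s, t; split => //.
rewrite [in RHS]addrCA -e1 [in RHS]addrCA -e2 !fctE /= !scale0r !add0r; ring.
Qed.

(** The second difference is symmetric in v and w, so the two mixed derivatives agree at suitable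
    points of a small parallelogram; continuity brings both points to u. *)
Lemma schwarz f u v w (U : set V) : open U -> U u ->
  (forall z, U z -> derivable f z v) -> (forall z, U z -> derivable f z w) ->
  (forall z, U z -> derivable ('D_v f) z w) ->
  (forall z, U z -> derivable ('D_w f) z v) ->
  {for u, continuous ('D_w ('D_v f))} -> {for u, continuous ('D_v ('D_w f))} ->
  'D_w ('D_v f) u = 'D_v ('D_w f) u.
Proof.
move=> oU Uu fv fw fvw fwv c1 c2.
apply/eqP; rewrite -subr_eq0 -normr_le0; apply/ler_addgt0Pr => e e0.
rewrite add0r.
have e20 : 0 < e / 2 by rewrite divr_gt0.
have n1 : \forall z \near u, `|'D_w ('D_v f) u - 'D_w ('D_v f) z| <= e / 2.
  by move/cvgrPdist_le : c1; apply.
have n2 : \forall z \near u, `|'D_v ('D_w f) u - 'D_v ('D_w f) z| <= e / 2.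
  by move/cvgrPdist_le : c2; apply.
have nU : \forall z \near u, U z by exact: open_nbhs_nbhs.
have [r /= r0 rP] := (@nbhs_ballP R V u _).1 (filterI nU (filterI n1 n2)).
(* With side parameter r / l the parallelogram stays in the ball of radius r; the 1 makes l positive
   and the bound strict. *)
set l := `|v| + `|w| + 1.
have l0 : 0 < l by rewrite ltr_wpDl // addr_ge0.
pose d := r / l.
have d0 : 0 < d by rewrite divr_gt0.
have inb s t : 0 <= s <= d -> 0 <= t <= d -> ball u r (s *: v + (t *: w + u)).
  move=> /andP[s0 sd] /andP[t0 td].
  rewrite -ball_normE /= addrA opprD addrCA subrr addr0 normrN.
  apply: le_lt_trans (ler_normD _ _) _; rewrite !normrZ !ger0_norm //.
  apply: (@le_lt_trans _ _ (d * (`|v| + `|w|))).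
    by rewrite mulrDr lerD // ler_wpM2r.
  by rewrite -[X in _ < X](divfK (lt0r_neq0 l0)) -/d ltr_pM2l // ltrDl.
have inU s t : 0 <= s <= d -> 0 <= t <= d -> U (s *: v + (t *: w + u)).
  by move=> sd td; exact: (rP _ (inb _ _ sd td)).1.
have inU' t s : 0 <= t <= d -> 0 <= s <= d -> U (t *: w + (s *: v + u)).
  by move=> td sd; rewrite addrCA; exact: inU.
have [s [t [sd td e1]]] := @MVT_mixed f u v w d d0
  (fun s t sd td => fv _ (inU s t sd td)) (fun s t sd td => fvw _ (inU s t sd td)).
have [t' [s' [td' sd' e2]]] := @MVT_mixed f u w v d d0
  (fun s t sd td => fw _ (inU' s t sd td)) (fun s t sd td => fwv _ (inU' s t sd td)).
have b1 := (rP _ (inb _ _ sd td)).2.1.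
have b2 := (rP _ (inb _ _ sd' td')).2.2.
rewrite [t' *: w + _]addrCA in e2.
move: b1 b2 e1 e2; move: ('D_w ('D_v f) u) ('D_v ('D_w f) u).
move: ('D_w ('D_v f) _) ('D_v ('D_w f) _) => A' B' A B b1 b2 e1 e2.
have AB : A' = B'.
  apply: (mulfI (lt0r_neq0 d0)); apply: (mulfI (lt0r_neq0 d0)).
  by rewrite -e1 -e2 [d *: w + (d *: v + u)]addrCA; ring.
have -> : A - B = (A - A') - (B - B') by rewrite AB; ring.
by rewrite (le_trans (ler_normB _ _)) // (splitr e) lerD.
Qed.

End Schwarz.

Lemma partialC (R : realType) (n : nat) (U : set 'rV[R]_n)
    (f : 'rV[R]_n -> R) i j u :
  open U -> Ck 2 U f -> U u ->
  partial i (partial j f) u = partial j (partial i f) u.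
Proof.
move=> oU hf Uu; apply: (@schwarz _ _ _ _ _ _ U) => //.
- by move=> z Uz; apply: (Ck_derivable hf Uz).
- by move=> z Uz; apply: (Ck_derivable hf Uz).
- by move=> z Uz; apply: (Ck_derivable (Ck_partial j hf) Uz).
- by move=> z Uz; apply: (Ck_derivable (Ck_partial i hf) Uz).
- exact: (Ck_continuous (Ck_partial i (Ck_partial j hf)) Uu).
- exact: (Ck_continuous (Ck_partial j (Ck_partial i hf)) Uu).
Qed.

(** * The ring of smooth functions on an open set *)

Record openSet (R : realType) (n : nat) := OpenSet {
  oset : set 'rV[R]_n;
  osetP : open oset
}.

(* The junk value 0 off [U] makes equality on [O] the equality of the type. *)
Record sfun (R : realType) (n : nat) (O : openSet R n) := SFun {
  sfun_fun :> 'rV[R]_n -> R;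
  sfun_smooth : smooth (oset O) sfun_fun;
  sfun_out : forall u, ~ oset O u -> sfun_fun u = 0
}.

Section SFunRing.
Variables (R : realType) (n : nat) (O : openSet R n).
Local Notation U := (oset O).
Let oO : open U := @osetP R n O.
Implicit Types f g h : sfun O.

Lemma sfunP f g : (forall u, U u -> f u = g u) -> f = g.
Proof.
move=> fg; have fgE : sfun_fun f = sfun_fun g.
  apply/funext => u; have [Uu|Uu] := pselect (U u); first exact: fg.
  by rewrite !sfun_out.
case: f g fgE {fg} => [f f1 f2] [g g1 g2] /= fg; move: f1 f2 g1 g2; rewrite fg.
by move=> f1 f2 g1 g2; congr (SFun _ _); exact: Prop_irrelevance.
Qed.

Definition restr0 (f : 'rV[R]_n -> R) u : R := if `[< U u >] then f u else 0.

Lemma restr0E (f : 'rV[R]_n -> R) u : U u -> restr0 f u = f u.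
Proof. by move=> Uu; rewrite /restr0 asboolT. Qed.

Lemma restr0_smooth (f : 'rV[R]_n -> R) : smooth U f -> smooth U (restr0 f).
Proof.
move=> sf k; apply: eq_Ck (sf k); first exact: oO.
by move=> u; rewrite inE => Uu; rewrite restr0E.
Qed.

Lemma restr0_out (f : 'rV[R]_n -> R) u : ~ U u -> restr0 f u = 0.
Proof. by move=> Uu; rewrite /restr0 asboolF. Qed.

(* Opaque, lest unification unfold every smooth function down to [restr0]. *)
Lemma mksfun_subproof (f : 'rV[R]_n -> R) (sf : smooth U f) :
  {h : sfun O | forall u, U u -> h u = f u}.
Proof. by exists (SFun (restr0_smooth sf) (@restr0_out f)); exact: restr0E. Qed.

Definition mksfun (f : 'rV[R]_n -> R) (sf : smooth U f) : sfun O :=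
  sval (mksfun_subproof sf).

Lemma mksfunE (f : 'rV[R]_n -> R) (sf : smooth U f) u : U u -> mksfun sf u = f u.
Proof. exact: svalP (mksfun_subproof sf) u. Qed.

Definition sfun_cst (c : R) : sfun O :=
  mksfun (fun k => Ck_cst k c oO).
Definition sfun_add f g : sfun O :=
  mksfun (fun k => Ck_add oO (@sfun_smooth _ _ _ f k) (@sfun_smooth _ _ _ g k)).
Definition sfun_mul f g : sfun O :=
  mksfun (fun k => Ck_mul oO (@sfun_smooth _ _ _ f k) (@sfun_smooth _ _ _ g k)).
Definition sfun_opp f : sfun O :=
  mksfun (fun k => Ck_opp oO (@sfun_smooth _ _ _ f k)).
Definition sfun_exp f : sfun O :=
  mksfun (fun k => Ck_expR oO (@sfun_smooth _ _ _ f k)).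
(** Opaque for the same reason as [mksfun_subproof]. *)
Lemma pd_subproof (i : 'I_n) f :
  {h : sfun O | forall u, U u -> h u = partial i f u}.
Proof. exact: mksfun_subproof (fun k => Ck_partial i (@sfun_smooth _ _ _ f k.+1)). Qed.

Definition pd (i : 'I_n) f : sfun O := sval (pd_subproof i f).

Lemma pd_partial i f u : U u -> pd i f u = partial i f u.
Proof. exact: svalP (pd_subproof i f) u. Qed.

HB.instance Definition _ := gen_eqMixin (sfun O).
HB.instance Definition _ := gen_choiceMixin (sfun O).

Fact sfun_addA : associative sfun_add.
Proof. by move=> f g h; apply: sfunP => u Uu; rewrite !mksfunE // addrA. Qed.
Fact sfun_addC : commutative sfun_add.
Proof. by move=> f g; apply: sfunP => u Uu; rewrite !mksfunE // addrC. Qed.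
Fact sfun_add0 : left_id (sfun_cst 0) sfun_add.
Proof. by move=> f; apply: sfunP => u Uu; rewrite !mksfunE // add0r. Qed.
Fact sfun_addN : left_inverse (sfun_cst 0) sfun_opp sfun_add.
Proof. by move=> f; apply: sfunP => u Uu; rewrite !mksfunE // addNr. Qed.
HB.instance Definition _ :=
  GRing.isZmodule.Build (sfun O) sfun_addA sfun_addC sfun_add0 sfun_addN.

Fact sfun_mulA : associative sfun_mul.
Proof. by move=> f g h; apply: sfunP => u Uu; rewrite !mksfunE // mulrA. Qed.
Fact sfun_mulC : commutative sfun_mul.
Proof. by move=> f g; apply: sfunP => u Uu; rewrite !mksfunE // mulrC. Qed.
Fact sfun_mul1 : left_id (sfun_cst 1) sfun_mul.
Proof. by move=> f; apply: sfunP => u Uu; rewrite !mksfunE // mul1r. Qed.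
Fact sfun_mulDl : left_distributive sfun_mul sfun_add.
Proof. by move=> f g h; apply: sfunP => u Uu; rewrite !mksfunE // mulrDl. Qed.
HB.instance Definition _ :=
  GRing.Zmodule_isComPzRing.Build (sfun O) sfun_mulA sfun_mulC sfun_mul1 sfun_mulDl.

Section Evaluation.
Variables (u : 'rV[R]_n) (Uu : U u).

Lemma sfunD f g : (f + g) u = f u + g u. Proof. exact: mksfunE. Qed.
Lemma sfunM f g : (f * g) u = f u * g u. Proof. exact: mksfunE. Qed.
Lemma sfunN f : (- f) u = - f u. Proof. exact: mksfunE. Qed.
Lemma sfun0 : (0 : sfun O) u = 0. Proof. exact: mksfunE. Qed.
Lemma sfun1 : (1 : sfun O) u = 1. Proof. exact: mksfunE. Qed.
Lemma sfunMn f k : (f *+ k) u = f u *+ k.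
Proof. by elim: k => [|k IH]; rewrite ?mulr0n ?sfun0 // !mulrS sfunD IH. Qed.
Lemma sfunX f k : (f ^+ k) u = f u ^+ k.
Proof. by elim: k => [|k IH]; rewrite ?expr0 ?sfun1 // !exprS sfunM IH. Qed.
Lemma sfun_sum (I : Type) (r : seq I) (Q : pred I) (F : I -> sfun O) :
  (\sum_(i <- r | Q i) F i) u = \sum_(i <- r | Q i) F i u.
Proof.
apply: (big_morph (fun f => f u)) => [f g|]; [exact: sfunD|exact: sfun0].
Qed.
Lemma sfun_cstE c : sfun_cst c u = c. Proof. exact: mksfunE. Qed.
Lemma sfun_expE f : sfun_exp f u = expR (f u). Proof. exact: mksfunE. Qed.
(** Derivatives are local, so f need only agree with g on the open set. *)
Lemma pdE i (f : 'rV[R]_n -> R) (g : sfun O) :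
  (forall v, U v -> f v = g v) -> partial i f u = pd i g u.
Proof.
move=> fg; rewrite pd_partial //; apply: (@eq_partial _ _ _ U) => //.
- by move=> v; rewrite inE; exact: fg.
- by rewrite inE.
Qed.
End Evaluation.

Lemma pd_derivation i : derivation (pd i).
Proof.
split=> f g; apply: sfunP => u Uu.
  rewrite sfunD // -(@pdE u Uu i (fun v => f v + g v)); last first.
    by move=> v Uv; rewrite sfunD.
  rewrite [LHS]deriveD; first by rewrite !pd_partial.
    exact: Ck_derivable (@sfun_smooth _ _ _ f 1) Uu.
  exact: Ck_derivable (@sfun_smooth _ _ _ g 1) Uu.
rewrite sfunD // !sfunM // -(@pdE u Uu i (fun v => f v * g v)); last first.
  by move=> v Uv; rewrite sfunM.
rewrite (partialM _ (@sfun_smooth _ _ _ f 1) (@sfun_smooth _ _ _ g 1) Uu).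
by rewrite !pd_partial.
Qed.

Lemma pdC i j f : pd i (pd j f) = pd j (pd i f).
Proof.
apply: sfunP => u Uu.
have e k l : partial k (partial l f) u = pd k (pd l f) u.
  by apply: pdE => // v Uv; rewrite pd_partial.
have c := partialC i j oO (@sfun_smooth _ _ _ f 2) Uu.
exact: (etrans (esym (e i j)) (etrans c (e j i))).
Qed.

Lemma pd_exp i f : pd i (sfun_exp f) = sfun_exp f * pd i f.
Proof.
apply: sfunP => u Uu; rewrite sfunM // sfun_expE //.
rewrite -(@pdE u Uu i (expR \o f)); last by move=> v Uv; rewrite sfun_expE.
by rewrite (partial_expR _ (@sfun_smooth _ _ _ f 1) Uu) pd_partial.
Qed.

End SFunRing.

(** * The Levi-Civita connection of Sol_3 *)

Section SolGeometry.
Variable R : realType.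
Implicit Types (p v w : 'rV[R]_3).

Definition k0 : 'I_3 := ord0.
Definition k1 : 'I_3 := @Ordinal 3 1 isT.
Definition k2 : 'I_3 := ord_max.

Lemma sum3 (M : nmodType) (F : 'I_3 -> M) :
  \sum_(i < 3) F i = F k0 + F k1 + F k2.
Proof.
rewrite !big_ord_recl big_ord0 addr0 addrA.
by congr (_ + F _ + F _); apply/val_inj.
Qed.

Lemma ord3E (i : 'I_3) : [\/ i = k0, i = k1 | i = k2].
Proof.
by case: i => [[|[|[|//]]] hi];
  [constructor 1|constructor 2|constructor 3]; exact: val_inj.
Qed.

Definition sol_diag p (k : 'I_3) : R :=
  [:: expR (2 * sol_z p); expR (- 2 * sol_z p); 1]`_k.

Lemma sol_metricE p i j : sol_metric p i j = sol_diag p i *+ (i == j).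
Proof. by rewrite /sol_metric !mxE. Qed.

Lemma sol_inner p v w : inner (@sol_metric R) p v w =
  expR (2 * sol_z p) * v 0 k0 * w 0 k0 + expR (- 2 * sol_z p) * v 0 k1 * w 0 k1
  + v 0 k2 * w 0 k2.
Proof.
rewrite /inner !mxE sum3 !mxE !sum3 !sol_metricE /sol_diag /=.
by rewrite !mulr0n !mulr1n; ring.
Qed.

Lemma sol_invmx p : invmx (sol_metric p) =
  \matrix_(i, j) ([:: expR (- 2 * sol_z p); expR (2 * sol_z p); 1]`_i *+ (i == j)).
Proof.
set B := RHS.
have e1 : expR (2 * sol_z p) * expR (- 2 * sol_z p) = 1.
  by rewrite -expRD mulNr subrr expR0.
have AB : sol_metric p *m B = 1%:M.
  apply/matrixP => i j; rewrite mxE sum3 !sol_metricE /B !mxE /sol_diag.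
  case: (ord3E i) => ->; case: (ord3E j) => -> /=;
    by rewrite ?(mulr0n, mulr1n, mulr0, mul0r, addr0, add0r, mulr1) // mulrC.
have uA : sol_metric p \in unitmx by case: (mulmx1_unit AB).
by rewrite -[LHS]mulmx1 -AB mulKmx.
Qed.

Lemma partial_sol_exp i (c : R) p :
  partial i (fun q => expR (c * sol_z q)) p
  = (c * expR (c * sol_z p)) *+ (i == k2).
Proof.
have dz : is_derive p (delta_mx 0 i : 'rV[R]_3) (@sol_z R) (i == k2)%:R.
  have did := @derivable_id R 'rV[R]_3 p (delta_mx 0 i).
  apply: DeriveDef; first by move/derivable_mxP : did; apply.
  have := derive_mx did; rewrite derive_id => /matrixP/(_ 0 k2).
  by rewrite !mxE eqxx /= eq_sym => ->.
have dcz : is_derive p (delta_mx 0 i : 'rV[R]_3) (fun q => c * sol_z q)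
    (c * (i == k2)%:R) by exact: is_deriveZ.
have [_] := is_derive_comp_expR dcz; rewrite /partial => ->.
by case: (i == k2); rewrite /= ?mulr1n ?mulr0n; ring.
Qed.

Lemma partial_sol_metric i j l p :
  partial i (fun q => sol_metric q j l) p
  = ([:: 2 * expR (2 * sol_z p); - 2 * expR (- 2 * sol_z p); 0]`_j)
    *+ ((j == l) && (i == k2)).
Proof.
have cst (c : R) : partial i (fun=> c) p = 0 by rewrite /partial derive_cst.
have -> : (fun q => sol_metric q j l) = (fun q : 'rV[R]_3 => sol_diag q j *+ (j == l)).
  by apply/funext => q; rewrite sol_metricE.
case: (j == l); rewrite /= ?mulr0n ?cst //.
case: (ord3E j) => ->; rewrite /sol_diag /= ?partial_sol_exp ?cst ?mul0rn //.
Qed.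

Lemma sol_christoffel c a b p : christoffel (@sol_metric R) c a b p =
  if c == k0 then ((a == k0) && (b == k2) || (a == k2) && (b == k0))%:R
  else if c == k1 then - ((a == k1) && (b == k2) || (a == k2) && (b == k1))%:R
  else expR (- 2 * sol_z p) *+ ((a == k1) && (b == k1))
       - expR (2 * sol_z p) *+ ((a == k0) && (b == k0)).
Proof.
have e1 : expR (- 2 * sol_z p) * expR (2 * sol_z p) = 1.
  by rewrite -expRD mulNr addNr expR0.
rewrite /christoffel sol_invmx sum3 !mxE !partial_sol_metric.
case: (ord3E c) => ->; case: (ord3E a) => ->; case: (ord3E b) => -> /=;
  rewrite ?(mulr0n, mulr1n, mulr0, mul0r, addr0, add0r, subr0, sub0r, oppr0) //.
all: try (by field).
(* The mixed symbols with x, z and with y, z remain, where two opposite exponentials multiply to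
   1. *)
- by rewrite -[RHS]e1; field.
- by rewrite -[RHS]e1; field.
- by rewrite -[X in _ = - X]e1; field.
- by rewrite -[X in _ = - X]e1; field.
Qed.

Lemma sol_covder_along n (F V : 'rV[R]_n -> 'rV[R]_3) i u (z := sol_z (F u))
    (D := covder_along (@sol_metric R) F i V u) (dF := partial i F u) :
  [/\ D 0 k0 = partial i V u 0 k0 + (dF 0 k0 * V u 0 k2 + dF 0 k2 * V u 0 k0),
      D 0 k1 = partial i V u 0 k1 - (dF 0 k1 * V u 0 k2 + dF 0 k2 * V u 0 k1) &
      D 0 k2 = partial i V u 0 k2 - expR (2 * z) * dF 0 k0 * V u 0 k0
               + expR (- 2 * z) * dF 0 k1 * V u 0 k1].
Proof.
by split; rewrite /D /covder_along !mxE !sum3 !sol_christoffel /=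
  ?(mulr0n, mulr1n) -/dF -/z; ring.
Qed.

Lemma inner_sumB p v w (a b : R) w0 w1 :
  inner (@sol_metric R) p v (w - (a *: w0 + b *: w1)) =
  inner (@sol_metric R) p v w - a * inner (@sol_metric R) p v w0
  - b * inner (@sol_metric R) p v w1.
Proof. by rewrite !sol_inner !mxE; ring. Qed.

End SolGeometry.

(** * A coordinate patch *)

Definition smooth_coef (R : realType) (n m p : nat) (O : openSet R n)
    (f : 'rV[R]_n -> 'M[R]_(m, p)) (sf : smooth (oset O) f) i j : sfun O :=
  mksfun (fun k => Ck_coef i j (@osetP R n O) (sf k)).

Lemma smooth_coefE (R : realType) (n m p : nat) (O : openSet R n)
    (f : 'rV[R]_n -> 'M[R]_(m, p)) (sf : smooth (oset O) f) i j u :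
  oset O u -> smooth_coef sf i j u = f u i j.
Proof. exact: mksfunE. Qed.

Lemma partial_rep (R : realType) (n m : nat) (O : openSet R n)
    (f : 'rV[R]_n -> 'rV[R]_m) (s : 'I_m -> sfun O) i k u :
  (forall v, oset O v -> forall k, f v 0 k = s k v) -> oset O u ->
  partial i f u 0 k = pd i (s k) u.
Proof.
move=> fs Ou; have df : derivable f u (delta_mx 0 i).
  apply/derivable_mxP => i' j; rewrite (ord1 i').
  apply: near_eq_derivable (Ck_derivable (@sfun_smooth _ _ _ (s j) 1) Ou).
  apply: near_eq_open (@osetP R n O) _ Ou => v; rewrite inE => Ov.
  by rewrite fs.
rewrite -(partial_coef 0 k df); apply: pdE => // v Ov.
exact: fs.
Qed.

Lemma mx_subE (V : zmodType) (m n : nat) (A B : 'M[V]_(m, n)) i j :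
  (A - B) i j = A i j - B i j.
Proof. by rewrite !mxE. Qed.

Lemma det2E (C : comPzRingType) (A : 'M[C]_2) :
  \det A = A ord0 ord0 * A ord_max ord_max - A ord0 ord_max * A ord_max ord0.
Proof.
rewrite (expand_det_row A ord0) sum2 /cofactor !det_mx11 !mxE /=.
have -> : lift ord0 0 = ord_max :> 'I_2 by exact: val_inj.
have -> : lift ord_max 0 = ord0 :> 'I_2 by exact: val_inj.
by rewrite addn0 add0n expr0 expr1; ring.
Qed.

Lemma innerE (R : realType) (n : nat) (g : 'rV[R]_n -> 'M[R]_n) u v w :
  inner g u v w = \sum_(j < n) (\sum_(i < n) v 0 i * g u i j) * w 0 j.
Proof. by rewrite /inner mxE; apply: eq_bigr => j _; rewrite !mxE. Qed.

Section Patch.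
Variables (R : realType) (O : openSet R 2) (g : 'rV[R]_2 -> 'M[R]_2).
Variables (F N : 'rV[R]_2 -> 'rV[R]_3) (X : 'I_2 -> 'rV[R]_2 -> 'rV[R]_2).
Local Notation U := (oset O).
Hypotheses (sF : smooth U F) (sN : smooth U N).
Hypothesis hg : forall u i j, U u ->
  g u i j = inner (@sol_metric R) (F u) (partial i F u) (partial j F u).
Hypothesis hN1 : forall u, U u -> inner (@sol_metric R) (F u) (N u) (N u) = 1.
Hypothesis hN0 : forall u i, U u ->
  inner (@sol_metric R) (F u) (N u) (partial i F u) = 0.
Hypothesis hX : orthonormal_frame g U X.

Let Fc k : sfun O := smooth_coef sF 0 k.
Let Nc k : sfun O := smooth_coef sN 0 k.
Let Xc a i : sfun O := smooth_coef (hX.1 a) 0 i.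
Let ez := sfun_exp (Fc k2).
Let emz := sfun_exp (- Fc k2).
(** From coordinate components to components in (E1, E2, E3), as d_x = e^z E1 and d_y = e^(-z)
    E2. *)
Let toE (v : 'I_3 -> sfun O) : sfun O * sfun O * sfun O :=
  (ez * v k0, emz * v k1, v k2).
Let Pc i := toE (fun k => pd i (Fc k)).
Let nc := toE Nc.
Let half : sfun O := sfun_cst O 2^-1.
Let pdc : 'I_2 -> sfun O -> sfun O := fun i => pd i.

Lemma repF u k : U u -> Fc k u = F u 0 k. Proof. exact: smooth_coefE. Qed.
Lemma repN u k : U u -> Nc k u = N u 0 k. Proof. exact: smooth_coefE. Qed.
Lemma repX u a k : U u -> Xc a k u = X a u 0 k. Proof. exact: smooth_coefE. Qed.
Lemma repdF u i k : U u -> pd i (Fc k) u = partial i F u 0 k.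
Proof. by move=> Uu; rewrite (partial_rep (s := Fc)) // => v Uv l; rewrite repF. Qed.
Lemma repdN u i k : U u -> pd i (Nc k) u = partial i N u 0 k.
Proof. by move=> Uu; rewrite (partial_rep (s := Nc)) // => v Uv l; rewrite repN. Qed.

Lemma ezE u : U u -> ez u = expR (sol_z (F u)).
Proof. by move=> Uu; rewrite sfun_expE // repF. Qed.
Lemma emzE u : U u -> emz u = expR (- sol_z (F u)).
Proof. by move=> Uu; rewrite sfun_expE // sfunN // repF. Qed.

Lemma rep_inner u (v w : 'I_3 -> sfun O) (V W : 'rV[R]_3) : U u ->
  (forall k, v k u = V 0 k) -> (forall k, w k u = W 0 k) ->
  dot (toE v) (toE w) u = inner (@sol_metric R) (F u) V W.
Proof.
move=> Uu vV wW; rewrite sol_inner /dot /= !(sfunD Uu, sfunM Uu) ezE // emzE // !vV !wW.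
have -> : 2 * sol_z (F u) = sol_z (F u) + sol_z (F u) by ring.
have -> : -2 * sol_z (F u) = - sol_z (F u) + - sol_z (F u) by ring.
rewrite !expRD; ring.
Qed.

Lemma pd_ez i : pd i ez = ez * pd i (Fc k2). Proof. exact: pd_exp. Qed.
Lemma pd_emz i : pd i emz = emz * - pd i (Fc k2).
Proof. by rewrite /emz pd_exp (derN (pd_derivation _ _)). Qed.

Lemma patch_torsion :
  nab (pdc ord0) (Pc ord0) (Pc ord_max) = nab (pdc ord_max) (Pc ord_max) (Pc ord0).
Proof.
exact: (nab_solvecC (Fc k0) (Fc k1) (pd_derivation O ord0) (pd_derivation O ord_max)
  (@pdC R 2 O ord0 ord_max) (pd_ez ord0) (pd_emz ord0) (pd_ez ord_max) (pd_emz ord_max)).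
Qed.

Lemma rep_g u i j : U u -> dot (Pc i) (Pc j) u = g u i j.
Proof. by move=> Uu; rewrite hg //; apply: rep_inner => // k; exact: repdF. Qed.

Lemma patch_frame a b :
  \sum_(i < 2) \sum_(j < 2) Xc a i * dot (Pc i) (Pc j) * Xc b j = (a == b)%:R.
Proof.
apply: sfunP => u Uu; rewrite sfunMn // sfun1 // -(hX.2 u a b Uu) innerE.
rewrite exchange_big sfun_sum //; apply: eq_bigr => j _.
rewrite sfun_sum // mulr_suml; apply: eq_bigr => i _.
by rewrite !sfunM // !repX // rep_g.
Qed.

Lemma patch_unit : dot nc nc = 1.
Proof.
apply: sfunP => u Uu; rewrite sfun1 // -(hN1 Uu).
by apply: rep_inner => // k; exact: repN.
Qed.

Lemma patch_normal i : dot nc (Pc i) = 0.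
Proof.
apply: sfunP => u Uu; rewrite sfun0 // -(hN0 i Uu).
by apply: rep_inner => // k; [exact: repN|exact: repdF].
Qed.

(** The link between the two forms of the ambient connection: [nab_solvec] in the frame and
    [sol_covder_along] with Christoffel symbols. *)
Lemma rep_nab u i l : U u ->
  dot (nabP pdc Pc i nc) (Pc l) u =
  inner (@sol_metric R) (F u) (covder_along (@sol_metric R) F i N u) (partial l F u).
Proof.
move=> Uu; pose w (k : 'I_3) : sfun O :=
  [:: pd i (Nc k0) + (pd i (Fc k0) * Nc k2 + pd i (Fc k2) * Nc k0);
      pd i (Nc k1) - (pd i (Fc k1) * Nc k2 + pd i (Fc k2) * Nc k1);
      pd i (Nc k2) - ez * ez * pd i (Fc k0) * Nc k0
        + emz * emz * pd i (Fc k1) * Nc k1]`_k.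
have -> : nabP pdc Pc i nc = toE w.
  exact: (nab_solvec (Fc k0) (Fc k1) (Nc k0) (Nc k1) (Nc k2)
    (pd_derivation O i) (pd_ez i) (pd_emz i)).
apply: rep_inner => // k; last exact: repdF.
have [c0 c1 c2] := sol_covder_along F N i u.
have z2 : 2 * sol_z (F u) = sol_z (F u) + sol_z (F u) by ring.
have z2' : -2 * sol_z (F u) = - sol_z (F u) + - sol_z (F u) by ring.
have ev := (sfunD Uu, sfunM Uu, sfunN Uu).
have rF := (repdF i k0 Uu, repdF i k1 Uu, repdF i k2 Uu).
have rN := (repdN i k0 Uu, repdN i k1 Uu, repdN i k2 Uu).
have r := (repN k0 Uu, repN k1 Uu, repN k2 Uu).
case: (ord3E k) => ->.
- by rewrite c0 /w /= !ev !rF !rN !r.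
- by rewrite c1 /w /= !ev !rF !rN !r.
- by rewrite c2 /w /= z2 z2' !expRD !ev !rF !rN !r (ezE Uu) (emzE Uu).
Qed.

Lemma patch_ginv u : U u -> g u *m (\matrix_(k, l) ginvC Xc k l u) = 1%:M.
Proof.
move=> Uu; apply/matrixP => a b; rewrite !mxE.
transitivity ((\sum_(k < 2) metC Pc a k * ginvC Xc k b) u).
  by rewrite sfun_sum //; apply: eq_bigr => k _; rewrite sfunM // rep_g // mxE.
by rewrite (metC_ginv patch_frame) sfunMn // sfun1.
Qed.

Lemma rep_ginv u i j : U u -> invmx (g u) i j = ginvC Xc i j u.
Proof.
move=> Uu; have uA : g u \in unitmx by case: (mulmx1_unit (patch_ginv Uu)).
by rewrite -[invmx _]mulmx1 -(patch_ginv Uu) mulKmx // mxE.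
Qed.

Lemma patch_det_neq0 u : U u -> \det (g u) != 0.
Proof.
by move=> Uu; rewrite -unitfE -unitmxE; case: (mulmx1_unit (patch_ginv Uu)).
Qed.

Lemma rep_chr u k i j : U u ->
  christoffel g k i j u = chrC half pdc Pc Xc k i j u.
Proof.
move=> Uu; rewrite /christoffel /chrC sfunM // sfun_cstE //; congr (_ * _).
rewrite sfun_sum //; apply: eq_bigr => l _; rewrite rep_ginv // sfunM //.
have e a b c : partial a (fun v => g v b c) u = pd a (metC Pc b c) u.
  by apply: pdE => // v Uv; rewrite -rep_g.
by rewrite !e !(sfunD Uu) (sfunN Uu).
Qed.

(** Agreement is required on [U] only, since elements of the ring vanish outside it. *)
Definition rep_fld (y : 'I_2 -> sfun O) (Y : 'rV[R]_2 -> 'rV[R]_2) :=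
  forall v, U v -> forall k, Y v 0 k = y k v.

Lemma rep_covder x y A B : rep_fld x A -> rep_fld y B ->
  rep_fld (covC half pdc Pc Xc x y) (covder g A B).
Proof.
move=> xA yB u Uu k; rewrite mxE sfun_sum //; apply: eq_bigr => i _.
rewrite sfunM // sfunD // xA // (partial_rep i k yB Uu) sfun_sum //.
congr (_ * (_ + _)); apply: eq_bigr => j _.
by rewrite sfunM // rep_chr // yB.
Qed.

Lemma rep_coordf i : rep_fld (delC (sfun O) i) (coordf i).
Proof.
by move=> u Uu k; rewrite mxE eqxx /= /delC sfunMn // sfun1.
Qed.

Lemma rep_div y Y u : rep_fld y Y -> U u ->
  div g Y u = divC half pdc Pc Xc y u.
Proof.
move=> yY Uu; rewrite sfun_sum //; apply: eq_bigr => i _.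
exact: (rep_covder (rep_coordf i) yY Uu).
Qed.

Lemma rep_grad (f : 'rV[R]_2 -> R) (s : sfun O) :
  (forall v, U v -> f v = s v) -> rep_fld (gradC pdc Xc s) (grad g f).
Proof.
move=> fs u Uu k; rewrite mxE sfun_sum //; apply: eq_bigr => j _.
by rewrite sfunM // rep_ginv //; congr (_ * _); apply: pdE.
Qed.

Lemma rep_innC x y A B u : rep_fld x A -> rep_fld y B -> U u ->
  inner g u (A u) (B u) = innC Pc x y u.
Proof.
move=> xA yB Uu; rewrite innerE sfun_sum //; apply: eq_bigr => j _.
rewrite sfunM // yB // sfun_sum //; congr (_ * _); apply: eq_bigr => i _.
by rewrite sfunM // xA // rep_g.
Qed.

Let A := shape_operator g F N.

Lemma rep_shape u i j : U u -> A u i j = shpC pdc Pc nc Xc i j u.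
Proof.
move=> Uu; rewrite !mxE sfun_sum //; apply: eq_bigr => l _.
rewrite sfunM // sfunN // rep_nab // rep_ginv //; congr (_ * _).
by rewrite !sol_inner !mxE; ring.
Qed.

Lemma rep_app y Y : rep_fld y Y ->
  rep_fld (appC pdc Pc nc Xc y) (fun v => Y v *m A v).
Proof.
move=> yY u Uu k; rewrite mxE sfun_sum //; apply: eq_bigr => i _.
by rewrite sfunM // rep_shape // yY.
Qed.

Lemma rep_tan : rep_fld (tanC Pc Xc) (tangent_part g F (@sol_E3 R \o F)).
Proof.
move=> u Uu k; rewrite mxE sfun_sum //; apply: eq_bigr => l _.
rewrite sfunM // rep_ginv //; congr (_ * _).
by rewrite sol_inner !mxE /= repdF //; ring.
Qed.

(** The tangent part removed from E is orthogonal to the normal. *)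
Lemma nuE E u : U u ->
  inner (@sol_metric R) (F u) (N u) (normal_part g F E u)
  = inner (@sol_metric R) (F u) (N u) (E u).
Proof.
move=> Uu; rewrite /normal_part; set T := tangent_part g F E.
have -> : Defs.pushforward F T u = T u 0 ord0 *: partial ord0 F u
    + T u 0 ord_max *: partial ord_max F u by exact: sum2.
by rewrite inner_sumB !hN0 //; ring.
Qed.

Lemma nu1E u : U u -> inner (@sol_metric R) (F u) (N u) (@sol_E1 R (F u)) = nc.1.1 u.
Proof.
move=> Uu; rewrite sol_inner !mxE /= sfunM // ezE // repN //.
have -> : 2 * sol_z (F u) = sol_z (F u) + sol_z (F u) by ring.
rewrite expRD -[RHS]mulr1 -(expRxMexpNx_1 (sol_z (F u))); ring.
Qed.

Lemma nu2E u : U u -> inner (@sol_metric R) (F u) (N u) (@sol_E2 R (F u)) = nc.1.2 u.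
Proof.
move=> Uu; rewrite sol_inner !mxE /= sfunM // emzE // repN //.
have -> : -2 * sol_z (F u) = - sol_z (F u) + - sol_z (F u) by ring.
rewrite expRD -[RHS]mulr1 -(expRxMexpNx_1 (sol_z (F u))); ring.
Qed.

Lemma nu3E u : U u -> inner (@sol_metric R) (F u) (N u) (@sol_E3 R (F u)) = nc.2 u.
Proof. by move=> Uu; rewrite sol_inner !mxE /= repN //; ring. Qed.

Lemma rep_tr v : U v -> \tr (A v) = trC pdc Pc nc Xc v.
Proof.
by move=> Uv; rewrite sfun_sum //; apply: eq_bigr => i _; rewrite rep_shape.
Qed.

Lemma rep_tr2 v : U v -> \tr (A v *m A v) = tr2C pdc Pc nc Xc v.
Proof.
move=> Uv; rewrite sfun_sum //; apply: eq_bigr => i _.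
rewrite mxE sfun_sum //; apply: eq_bigr => j _.
by rewrite sfunM // !rep_shape.
Qed.

Lemma rep_frame a : rep_fld (Xc a) (X a).
Proof. by move=> v Uv k; rewrite repX. Qed.

Lemma rep_covshp a b :
  rep_fld (covshpC half pdc Pc nc Xc a b) (covder_end g A (X a) (X b)).
Proof.
move=> v Uv k; rewrite /covder_end mx_subE /covshpC (sfunD Uv) (sfunN Uv).
have rX := rep_covder (rep_frame a) (rep_frame b).
rewrite -(rep_covder (rep_frame a) (rep_app (rep_frame b)) Uv k).
by rewrite -(rep_app rX Uv k).
Qed.

Lemma half_add : half + half = 1.
Proof.
apply: sfunP => v Uv; rewrite (sfunD Uv) (sfun1 Uv) (sfun_cstE Uv).
by rewrite [RHS]splitr mul1r.
Qed.

Lemma rep_gauss u : U u -> gauss_curvature g u = gaussK pdc Pc Xc u.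
Proof.
move=> Uu; rewrite /gauss_curvature.
have rc : rep_fld (curvC half pdc Pc Xc) (curvature g ord0 ord_max ord_max).
  move=> v Uv k; rewrite /curvature mx_subE /curvC (sfunD Uv) (sfunN Uv).
  have r i := rep_covder (rep_coordf i) (rep_coordf ord_max).
  by rewrite -(rep_covder (rep_coordf ord0) (r ord_max) Uv k)
    -(rep_covder (rep_coordf ord_max) (r ord0) Uv k).
rewrite (rep_innC rc (rep_coordf ord0) Uu).
rewrite (gaussC half_add (pd_derivation O) (@pdC R 2 O) patch_torsion patch_frame
  patch_unit patch_normal) (sfunM Uu).
have -> : (metC Pc ord0 ord0 * metC Pc ord_max ord_max
    - metC Pc ord0 ord_max * metC Pc ord_max ord0) u = \det (g u).
  have e i j : metC Pc i j u = g u i j := rep_g i j Uu.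
  have ev (a b c d : sfun O) : (a * b - c * d) u = a u * b u - c u * d u.
    by rewrite (sfunD Uu) (sfunN Uu) !(sfunM Uu).
  by rewrite ev det2E; congr (_ * _ - _ * _); exact: e.
by rewrite mulfK // patch_det_neq0.
Qed.

(** Evaluation at a point of [U] is a ring morphism. The letters are kept abstract so that it stops
    at the terms of the identity without entering them. *)
Lemma eval_identity (L S gg gT dA dT K t f n AA AT n1 n2 : sfun O) u : U u ->
  half * L = S - 4 * gg - 2 * n * gT + 2 * dA - 6 * dT + 2 * K * (t - 2 * f ^+ 2)
    + 2 * n ^+ 2 * (t + 2 * f ^+ 2 - 3) - 2 * AA - 2 * f * AT + 2
    - 2 * (n2 ^+ 2 - n1 ^+ 2) ^+ 2 ->
  2^-1 * L u = S u - 4 * gg u - 2 * n u * gT u + 2 * dA u - 6 * dT u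
    + 2 * K u * (t u - 2 * f u ^+ 2) + 2 * n u ^+ 2 * (t u + 2 * f u ^+ 2 - 3)
    - 2 * AA u - 2 * f u * AT u + 2 - 2 * (n2 u ^+ 2 - n1 u ^+ 2) ^+ 2.
Proof.
move=> Uu /(congr1 (fun c : sfun O => c u)).
have ev := (sfunD Uu, sfunM Uu, sfunN Uu, sfunX Uu, sfunMn Uu, sfun1 Uu).
by rewrite !ev (sfun_cstE Uu).
Qed.

Theorem patch_simons u (Uu : U u) :
  let f := fun v => 2^-1 * \tr (A v) in
  let K := gauss_curvature g in
  let normA2 := fun v => \tr (A v *m A v) in
  let E1 := @sol_E1 R \o F in
  let E2 := @sol_E2 R \o F in
  let E3 := @sol_E3 R \o F in
  let T := tangent_part g F E3 in
  let nu := fun E v => inner (@sol_metric R) (F v) (N v) (normal_part g F E v) in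
  2^-1 * laplacian g (fun v => normA2 v + 2 * nu E3 v ^+ 2) u =
    norm2_covder_end g X A u
    - 4 * inner g u (grad g f u) (grad g f u)
    - 2 * nu E3 u * inner g u (grad g f u) (T u)
    + 2 * div g (fun v => grad g f v *m A v) u
    - 6 * div g (fun v => (f v * nu E3 v) *: T v) u
    + 2 * K u * (normA2 u - 2 * f u ^+ 2)
    + 2 * nu E3 u ^+ 2 * (normA2 u + 2 * f u ^+ 2 - 3)
    - 2 * inner g u (T u *m A u) (T u *m A u)
    - 2 * f u * inner g u (T u *m A u) (T u)
    + 2 - 2 * (nu E2 u ^+ 2 - nu E1 u ^+ 2) ^+ 2.
Proof.
move=> f K normA2 E1 E2 E3 T nu.
have main := coord_simons half_add (pd_derivation O) (@pdC R 2 O) patch_torsion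
  patch_frame patch_unit patch_normal.
have {main} := eval_identity Uu main.
set fc := half * trC pdc Pc nc Xc.
have fE v : U v -> f v = fc v.
  by move=> Uv; rewrite /f rep_tr // /fc (sfunM Uv) (sfun_cstE Uv).
have nE v : U v -> nu E3 v = nc.2 v by move=> Uv; rewrite /nu nuE // nu3E.
have rT : rep_fld (tanC Pc Xc) T := rep_tan.
have rG := rep_grad fE.
have rAT := rep_app rT.
rewrite -(rep_innC rG rG Uu) -(rep_innC rG rT Uu) -(rep_innC rAT rAT Uu).
rewrite -(rep_innC rAT rT Uu) -(rep_div (rep_app rG) Uu) -(rep_gauss Uu).
rewrite -(nE u Uu) -(fE u Uu) -(rep_tr2 Uu) -(nu1E Uu) -(nu2E Uu).
have rL : forall v, U v -> normA2 v + 2 * nu E3 v ^+ 2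
    = (tr2C pdc Pc nc Xc + 2 * nc.2 ^+ 2) v.
  move=> v Uv; rewrite /normA2 rep_tr2 // nE //.
  by rewrite (sfunD Uv) (sfunM Uv) (sfunX Uv) (sfunMn Uv) (sfun1 Uv).
rewrite -(rep_div (rep_grad rL) Uu).
have rD : rep_fld (fun j => fc * nc.2 * tanC Pc Xc j) (fun v => (f v * nu E3 v) *: T v).
  by move=> v Uv k; rewrite mxE (sfunM Uv) (sfunM Uv) rT // fE // nE.
rewrite -(rep_div rD Uu).
have -> : (\sum_(a < 2) \sum_(b < 2) innC Pc (covshpC half pdc Pc nc Xc a b)
    (covshpC half pdc Pc nc Xc a b)) u = norm2_covder_end g X A u.
  rewrite sfun_sum //; apply: eq_bigr => a _; rewrite sfun_sum //.
  apply: eq_bigr => b _.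
  by rewrite -(rep_innC (rep_covshp a b) (rep_covshp a b) Uu).
by move=> ->; rewrite /nu !nuE.
Qed.

End Patch.

(** * Restriction to the domain of the frame *)

Lemma smooth_subset (R : realType) (n : nat) (W : normedModType R)
    (U V : set 'rV[R]_n) (f : 'rV[R]_n -> W) :
  V `<=` U -> smooth U f -> smooth V f.
Proof.
move=> VU sf k; move: {sf}(sf k); elim: k f => [|k IH] f [fc fd]; split => //=;
  try by move=> u Vu; apply: fc; exact: VU.
move=> i; have [fd1 fd2] := fd i; split; last exact: IH.
by move=> u Vu; apply: fd1; exact: VU.
Qed.

Theorem proposition3p7 (R : realType) (Sigma : riemSurface R)
    (phi xi : Sigma -> 'rV[R]_3)
    (hphi : isometric_immersion phi) (hxi : unit_normal_field phi xi)
    (c : chart R Sigma) (hc : atlas c)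
    (V : set 'rV[R]_2) (hVopen : open V) (hV : V `<=` target c)
    (X : 'I_2 -> 'rV[R]_2 -> 'rV[R]_2)
    (hX : orthonormal_frame (metric c) V X)
    (u : 'rV[R]_2) (hu : V u) :
  let g := metric c in
  let F := phi \o param c in
  let N := xi \o param c in
  let A := shape_operator g F N in
  let f := fun v => 2^-1 * \tr (A v) in
  let K := gauss_curvature g in
  let normA2 := fun v => \tr (A v *m A v) in
  let E1 := @sol_E1 R \o F in
  let E2 := @sol_E2 R \o F in
  let E3 := @sol_E3 R \o F in
  let T := tangent_part g F E3 in
  let nu := fun E v => inner (@sol_metric R) (F v) (N v) (normal_part g F E v) in
  2^-1 * laplacian g (fun v => normA2 v + 2 * nu E3 v ^+ 2) u =
    norm2_covder_end g X A u
    - 4 * inner g u (grad g f u) (grad g f u)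
    - 2 * nu E3 u * inner g u (grad g f u) (T u)
    + 2 * div g (fun v => grad g f v *m A v) u
    - 6 * div g (fun v => (f v * nu E3 v) *: T v) u
    + 2 * K u * (normA2 u - 2 * f u ^+ 2)
    + 2 * nu E3 u ^+ 2 * (normA2 u + 2 * f u ^+ 2 - 3)
    - 2 * inner g u (T u *m A u) (T u *m A u)
    - 2 * f u * inner g u (T u *m A u) (T u)
    + 2 - 2 * (nu E2 u ^+ 2 - nu E1 u ^+ 2) ^+ 2.
Proof.
(* The ring is taken over [V], where the frame is smooth and orthonormal, and the data of the chart
   are restricted to it. *)
have [sF gF] := hphi c hc; have [sN nN] := hxi c hc.
exact: (@patch_simons R (OpenSet hVopen) (metric c) (phi \o param c) (xi \o param c) X
  (smooth_subset hV sF) (smooth_subset hV sN)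
  (fun v i j Vv => gF v i j (hV v Vv)) (fun v Vv => (nN v (hV v Vv)).1)
  (fun v i Vv => (nN v (hV v Vv)).2 i) hX u hu).
Qed.
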